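(* Let $V$ be a symplectic vector space over $\mathbb C$ with symplectic form $\Omega$, $\{e_a\}$ a basis of $V$, $\Omega_{ab}=\Omega(e_a,e_b)$, and let ${\rm Sf}[V]$ be the symplectic fermion VOA with generators $\eta^a$. The filtration $\mathfrak R_\bullet$ induced by giving each $\eta^a$ degree $\frac12$, the invariant bilinear form $(-,-)$, and the conjugation $\rho$ determined by $\rho(\eta^b)=-\mathrm i\,\Omega_{ab}\eta^a$ equip ${\rm Sf}[V]$ with the structure of a graded-unitary VOA.
   Context: Repeated indices are summed; $\Omega^{ab}$ is the inverse matrix, $\Omega_{ab}\Omega^{bc}=\delta_a^c$. Vertex algebras are over $\mathbb C$ and may have Grassmann-odd elements, $|x|$ is Grassmann parity, $Y(x,z)=\sum_nx_nz^{-n-1}$, $[\,,]$ is the graded commutator, $|0\rangle$ is the vacuum, $\partial$ is translation. ${\rm Sf}[V]$ is freely generated by $\dim V$ Grassmann-odd fields $\eta^a(z)=\sum_n\eta^a_nz^{-n-1}$ with $\eta^a(z)\eta^b(w)\sim\frac{\Omega^{ab}}{(z-w)^2}$, i.e. $[\eta^a_n,\eta^b_m]=n\Omega^{ab}\delta_{n+m,0}$, and has stress tensor $T=\frac12\Omega_{ab}:\!\eta^a\eta^b\!:$, giving $\eta^a$ conformal weight $1$. $L_{\pm1},L_0$ are modes of $T(z)=\sum_nL_nz^{-n-2}$. A bilinear form is invariant if $(Y(x,z)u,v)=(-1)^{|x||u|}(u,Y(e^{zL_1}(e^{\mathrm i\pi}z^{-2})^{L_0}x,z^{-1})v)$ and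 $(L_mu,v)=(u,L_{-m}v)$, $m\in\{-1,0,1\}$; the form used is the unique invariant one with $(|0\rangle,|0\rangle)=1$. Grading and filtration: ${\rm Sf}[V]_{\ell/2}={\rm span}\{\eta^{a_1}_{-n_1-1}\cdots\eta^{a_\ell}_{-n_\ell-1}|0\rangle\}$ (with $n_i\ge0$) for $\ell\ge0$ and $0$ for $\ell<0$; $\mathfrak R_{p+\alpha}{\rm Sf}[V]=\bigoplus_{p'\in\mathbb Z,\,p'\le p}{\rm Sf}[V]_{p'+\alpha}$ for $p\in\mathbb Z$, $\alpha\in\{0,\frac12\}$. On ${\rm Sf}[V]_R$ the $\mathbb Z_2$ parity $s$ acts by $(-1)^{2R}$ and $\sigma$ acts by $\mathrm i^{2R}$. Half-integral filtration of a $\mathbb Z_2$-graded vertex algebra $\mathcal V=\mathcal V^0\oplus\mathcal V^{1/2}$: increasing (in integer steps) and exhaustive, with components $\mathcal F_p\subseteq\mathcal V^0$ for $p\in\mathbb Z$ and $\mathcal F_p\subseteq\mathcal V^{1/2}$ for $p\in\frac12+\mathbb Z$, $|0\rangle\in\mathcal F_0$, and $x_ny\in\mathcal F_{p+q}$ for $x\in\mathcal F_p$, $y\in\mathcal F_q$, $n\in\mathbb Z$; good if also $x_ny\in\mathcal F_{p+q-1}$ for $n\ge0$; nondegenerate if $(-,-)$ restricts nondegenerately to every filtered component. A nondegenerate filtration is refined by orthogonality to a grading $\bigoplus\mathcal V_{h,R}$ ($h$ conformal weight, $R$ filtration degree), and $\sigma$ is defined as $\mathrm i^{2R}$ on degree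 $R$, so $\sigma^2=s$. A conjugation is an anti-linear isomorphism $\rho$ that commutes with $\partial$, fixes $|0\rangle$, satisfies $\rho(x_ny)=(-1)^{|x||y|}\rho(x)_n\rho(y)$, and preserves the conformal vector and each filtered component; it is a quaternionic structure if $\rho\circ\rho=s$ and $\rho\circ\sigma=\sigma^{-1}\circ\rho$. A graded-unitary VOA is a VOA with a nondegenerate invariant bilinear form, a nondegenerate half-integral good filtration and a quaternionic structure such that the Hermitian form $\langle x|y\rangle=((\sigma\circ\rho)(x),y)$ is positive-definite.
   Formalization: The basis is additionally assumed to make the matrix Ω_{ab} unitary (as for any Darboux basis); otherwise, e.g. for a Darboux basis scaled by c with |c| ≠ 1, the formula ρ(η^b) = -iΩ_{ab}η^a does not extend to a conjugation. *)

(* Defs.v *)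
From HB Require Import structures.
From mathcomp Require Import all_boot all_order all_algebra.
From mathcomp Require Export sesquilinear spectral.
From mathcomp Require Export reals.
From mathcomp Require Export complex.
From mathcomp Require Import ring.

Set Implicit Arguments.
Unset Strict Implicit.
Unset Printing Implicit Defensive.

Import Order.TTheory GRing.Theory Num.Theory.
Local Open Scope ring_scope.

(** * Linear algebra in possibly infinite-dimensional spaces.
    Subspaces are predicates [W -> Prop]. *)

Definition subspace (C : fieldType) (W : lmodType C) (P : W -> Prop) : Prop :=
  P 0 /\ forall (a : C) (x y : W), P x -> P y -> P (a *: x + y).

Definition lspan (C : fieldType) (W : lmodType C) (P : W -> Prop) (x : W) : Prop :=
  exists (m : nat) (c : 'I_m -> C) (y : 'I_m -> W),
    (forall i, P (y i)) /\ x = \sum_(i < m) c i *: y i.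

Definition finite_dim (C : fieldType) (W : lmodType C) (P : W -> Prop) : Prop :=
  exists (m : nat) (y : 'I_m -> W),
    forall x, P x -> exists c : 'I_m -> C, x = \sum_(i < m) c i *: y i.

Definition Z2_decomposition (C : fieldType) (W : lmodType C)
    (G : bool -> W -> Prop) : Prop :=
  [/\ forall b, subspace (G b),
      forall x, exists x0 x1, [/\ G false x0, G true x1 & x = x0 + x1]
    & forall x, G false x -> G true x -> x = 0].

Definition nondegenerate_on (C : fieldType) (W : lmodType C) (P : W -> Prop)
    (B : W -> W -> C) : Prop :=
  (forall x, P x -> (forall y, P y -> B x y = 0) -> x = 0) /\
  (forall y, P y -> (forall x, P x -> B x y = 0) -> y = 0).

Definition eventually (P : nat -> Prop) : Prop :=
  exists N : nat, forall M : nat, (N <= M)%N -> P M.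

(* m (m - 1) ... (m - j + 1) / j! for an integer m of any sign. *)
Definition gbinom (C : fieldType) (m : int) (j : nat) : C :=
  (\prod_(i < j) (m - i%:Z)%:~R) / (j`!)%:R.

(** * Vertex superalgebras *)

(* [nprod x n y] is x_n y, where Y(x,z) = sum_n x_n z^(-n-1), and
   [par p x] says that x has Grassmann parity p ([true] is odd).  The last
   axiom is the Borcherds (Jacobi) identity; by truncation all three of its
   sums are finite, so it is an equality of sufficiently long partial sums. *)
Record vertexAlgebra (C : numClosedFieldType) := VertexAlgebra {
  va_sort :> lmodType C;
  par : bool -> va_sort -> Prop;
  vac : va_sort;
  deriv : va_sort -> va_sort;
  nprod : va_sort -> int -> va_sort -> va_sort;
  par_dec : Z2_decomposition par;
  par_vac : par false vac;
  par_deriv : forall p x, par p x -> par p (deriv x);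
  par_nprod : forall p q x y n, par p x -> par q y ->
    par (p (+) q) (nprod x n y);
  deriv_linear : linear deriv;
  nprod_linearr : forall x n, linear (nprod x n);
  nprod_linearl : forall n y, linear (fun x => nprod x n y);
  nprod_trunc : forall x y, exists N : int, forall n, N <= n -> nprod x n y = 0;
  nprod_vacl : forall n y, nprod vac n y = if n == -1 then y else 0;
  nprod_vacr : forall x n, 0 <= n -> nprod x n vac = 0;
  nprod_create : forall x, nprod x (-1) vac = x;
  deriv_vac : deriv vac = 0;
  deriv_nprod : forall x n y,
    deriv (nprod x n y) - nprod x n (deriv y) = - n%:~R *: nprod x (n - 1) y;
  borcherds : forall p q x y v (m n k : int), par p x -> par q y ->
    eventually (fun M =>
      \sum_(j < M) gbinom C m j *: nprod (nprod x (n + j%:Z) y) (m + k - j%:Z) v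
      = \sum_(j < M) ((-1) ^+ j * gbinom C n j) *:
          (nprod x (m + n - j%:Z) (nprod y (k + j%:Z) v)
           - ((-1) ^ n * (-1) ^+ (p && q)) *:
             nprod y (n + k - j%:Z) (nprod x (m + j%:Z) v)))
}.

Arguments par {C} _ _ _.
Arguments vac {C} _.
Arguments deriv {C _} _.
Arguments nprod {C _} _ _ _.

Section VertexOperatorAlgebras.
Context {C : numClosedFieldType} {W : vertexAlgebra C}.
Implicit Types (om x y u v : W) (B : W -> W -> C).

(* T(z) = sum_n L_n z^(-n-2) *)
Definition Lmode om (m : int) x : W := nprod om (m + 1) x.

(* Weights are half-integers: [weight om k x] is L_0 x = (k/2) x. *)
Definition weight om (k : int) x : Prop := Lmode om 0 x = (k%:~R / 2%:R) *: x.

Definition virasoro om (c : C) : Prop :=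
  forall (m n : int) x,
    Lmode om m (Lmode om n x) - Lmode om n (Lmode om m x)
    = (m - n)%:~R *: Lmode om (m + n) x
      + (if m + n == 0 then (m ^+ 3 - m)%:~R / 12%:R * c else 0) *: x.

Record is_VOA om : Prop := IsVOA {
  voa_even : par W false om;
  voa_virasoro : exists c, virasoro om c;
  voa_deriv : forall x, Lmode om (-1) x = deriv x;
  voa_graded : forall x, lspan (fun y => exists k, weight om k y) x;
  voa_bounded : exists N : int, forall k x, k < N -> weight om k x -> x = 0;
  voa_finite : forall k, finite_dim (weight om k)
}.

(* The first clause is the coefficient of z^(-m-1) in
     (Y(x,z)u, v)
       = (-1)^(|x||u|) (u, Y(e^(zL_1) (e^(i pi) z^(-2))^(L_0) x, z^(-1)) v)
   for x of weight k/2: e^(i pi k/2) = i^k, and the term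
     i^k z^(j-k) / j! . (L_1^j x)_n z^(n+1)
   contributes for n = k - j - m - 2.  The sum over j is finite since L_0 is
   bounded below. *)
Definition invariant_form om B : Prop :=
  (forall p q (k m : int) x u v, weight om k x -> par W p x -> par W q u ->
    eventually (fun M =>
      B (nprod x m u) v =
      (-1) ^+ (p && q) *
        \sum_(j < M) 'i ^ k / (j`!)%:R *
          B u (nprod (iter j (Lmode om 1) x) (k - j%:Z - m - 2) v))) /\
  (forall m : int, m \in [:: -1; 0; 1] ->
    forall u v, B (Lmode om m u) v = B u (Lmode om (- m) v)).

(** * Filtrations, conjugations, graded unitarity.
    A half-integer degree p is encoded by the integer 2p: [F k] is F_(k/2).
    [G false] and [G true] are the components V^0 and V^(1/2). *)

Definition Z2_graded (G : bool -> W -> Prop) : Prop :=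
  Z2_decomposition G /\
  forall a b x y n, G a x -> G b y -> G (a (+) b) (nprod x n y).

Record half_integral_filtration (G : bool -> W -> Prop) (F : int -> W -> Prop)
    : Prop := HalfIntegralFiltration {
  filt_subspace : forall k, subspace (F k);
  filt_incr : forall k x, F k x -> F (k + 2) x;
  filt_sub : forall k x, F k x -> G (odd `|k|%N) x;
  filt_exhaustive : forall b x, G b x -> exists k : int, odd `|k|%N = b /\ F k x;
  filt_vac : F 0 (vac W);
  filt_nprod : forall k l n x y, F k x -> F l y -> F (k + l) (nprod x n y)
}.

Definition good_filtration (F : int -> W -> Prop) : Prop :=
  forall (k l n : int) x y, 0 <= n -> F k x -> F l y -> F (k + l - 2) (nprod x n y).

Definition nondegenerate_filtration B (F : int -> W -> Prop) : Prop :=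
  forall k, nondegenerate_on (F k) B.

(* V_(h,R) with R = k/2: the vectors of weight h in F_R orthogonal to F_(R-1). *)
Definition refined om B (F : int -> W -> Prop) (h k : int) x : Prop :=
  [/\ weight om h x, F k x
    & forall y, F (k - 2) y -> B x y = 0 /\ B y x = 0].

(* The V_(h,R) span, and sigma is i^(2R) on V_(h,R).  That their sum is direct
   follows from the nondegeneracy of the filtration. *)
Definition is_sigma om B (F : int -> W -> Prop) (sigma : W -> W) : Prop :=
  [/\ linear sigma,
      forall x, lspan (fun y => exists h k, refined om B F h k y) x
    & forall h k x, refined om B F h k x -> sigma x = 'i ^ k *: x].

Record conjugation om (F : int -> W -> Prop) (rho : W -> W) : Prop := Conjugation {
  conj_antilinear : forall (a : C) x y, rho (a *: x + y) = a^* *: rho x + rho y;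
  conj_bij : bijective rho;
  conj_deriv : forall x, rho (deriv x) = deriv (rho x);
  conj_vac : rho (vac W) = vac W;
  conj_nprod : forall p q x y n, par W p x -> par W q y ->
    rho (nprod x n y) = (-1) ^+ (p && q) *: nprod (rho x) n (rho y);
  conj_conformal : rho om = om;
  conj_filt : forall k x, F k x <-> F k (rho x)
}.

(* rho o rho = s, where s is the Z_2 parity of G, and
   rho o sigma = sigma^-1 o rho. *)
Definition quaternionic (G : bool -> W -> Prop) (sigma rho : W -> W) : Prop :=
  (forall b x, G b x -> rho (rho x) = (-1) ^+ b *: x) /\
  (forall x, sigma (rho (sigma x)) = rho x).

Record graded_unitary om (G : bool -> W -> Prop) (F : int -> W -> Prop) B
    (sigma rho : W -> W) : Prop := GradedUnitary {
  gu_VOA : is_VOA om;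
  gu_Z2 : Z2_graded G;
  gu_form : invariant_form om B;
  gu_form_nondeg : nondegenerate_on (fun _ => True) B;
  gu_filt : half_integral_filtration G F;
  gu_filt_good : good_filtration F;
  gu_filt_nondeg : nondegenerate_filtration B F;
  gu_sigma : is_sigma om B F sigma;
  gu_conj : conjugation om F rho;
  gu_quat : quaternionic G sigma rho;
  gu_herm : forall x y, B (sigma (rho x)) y = (B (sigma (rho y)) x)^*;
  gu_pos : forall x, x != 0 -> 0 < B (sigma (rho x)) x
}.

(** * Symplectic fermions *)

Section SymplecticFermions.
Context {n : nat}.
Implicit Types (Om : 'M[C]_n) (eta : 'I_n -> W).

(* The word [:: (a_1, n_1); ...; (a_l, n_l)] is sent to
   eta^(a_1)_(-n_1-1) ... eta^(a_l)_(-n_l-1) |0>. *)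
Definition monomial eta (w : seq ('I_n * nat)) : W :=
  foldr (fun p v => nprod (eta p.1) (- p.2%:Z - 1) v) (vac W) w.

Definition mode_lt (p q : 'I_n * nat) : bool :=
  (p.2 < q.2)%N || ((p.2 == q.2) && (p.1 < q.1)%N).

(* W is freely generated by odd fields eta^a with
   eta^a(z) eta^b(w) ~ Omega^(ab) / (z-w)^2: the creation modes anticommute, and
   free generation says that the strictly ordered monomials form a basis. *)
Record symplectic_fermions Om eta : Prop := SymplecticFermions {
  sf_odd : forall a, par W true (eta a);
  sf_ope : forall a b (k m : int) v,
    nprod (eta a) k (nprod (eta b) m v) + nprod (eta b) m (nprod (eta a) k v)
    = (if k + m == 0 then k%:~R * invmx Om a b else 0) *: v;
  sf_span : forall x,
    lspan (fun y => exists w, sorted mode_lt w /\ y = monomial eta w) x;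
  sf_free : forall (s : seq (seq ('I_n * nat))) (c : seq ('I_n * nat) -> C),
    uniq s -> all (sorted mode_lt) s ->
    \sum_(w <- s) c w *: monomial eta w = 0 -> {in s, forall w, c w = 0}
}.

Definition stress_tensor Om eta : W :=
  2%:R^-1 *: \sum_a \sum_b Om a b *: nprod (eta a) (-1) (eta b).

(* Sf[V]_(l/2); it is 0 for l < 0. *)
Definition Sf_deg eta (l : int) : W -> Prop :=
  lspan (fun y => exists w, (size w)%:Z = l /\ y = monomial eta w).

Definition Sf_Z2 eta (b : bool) : W -> Prop :=
  lspan (fun y => exists l : nat, odd l = b /\ Sf_deg eta l%:Z y).

(* R_(k/2) Sf[V] is the sum of the Sf[V]_(k/2 - i) for i in N. *)
Definition Sf_filt eta (k : int) : W -> Prop :=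
  lspan (fun y => exists i : nat, Sf_deg eta (k - 2 * i%:Z) y).

Definition rho_on_generators Om eta (rho : W -> W) : Prop :=
  forall b, rho (eta b) = - 'i *: \sum_a Om a b *: eta a.

End SymplecticFermions.
End VertexOperatorAlgebras.

Definition gram (C : fieldType) (V : lmodType C) (Omega : V -> V -> C)
  (n : nat) (e : n.-tuple V) : 'M[C]_n :=
  \matrix_(a, b) Omega (tnth e a) (tnth e b).

(** * The Gram matrix must be unitary
    [rho_on_generators] extends to a conjugation only if the matrix Omega_(ab) is
    unitary: applying rho to eta^a_1 eta^b = Omega^(ab) |0> gives
    (Omega^(ab))^* = Omega_(ba).  Darboux bases satisfy this, but, for example,
    multiples c e_a of a Darboux basis do so only when |c| = 1. *)
Lemma rho_on_generators_unitary (C : numClosedFieldType) (W : vertexAlgebra C)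
    (n : nat) (Om : 'M[C]_n) (eta : 'I_n -> W) (om : W) (F : int -> W -> Prop)
    (rho : W -> W) :
  Om \in unitmx -> symplectic_fermions Om eta -> conjugation om F rho ->
  rho_on_generators Om eta rho -> Om \is unitarymx.
Proof.
move=> Om_unit sf conjr rhoE.
have vac_neq0 : vac W != 0.
  apply/eqP=> v0.
  have /(_ isT isT) := sf_free sf (s := [:: [::]]) (c := fun=> 1).
  rewrite big_seq1 /= v0 scaler0 => /(_ erefl [::] (mem_head _ _)) /eqP.
  by rewrite oner_eq0.
have ope a b : nprod (eta a) 1 (eta b) = invmx Om a b *: vac W.
  have := sf_ope sf a b 1 (-1) (vac W).
  rewrite nprod_create (nprod_vacr (eta a) (n := 1)) // subrr eqxx mul1r => <-.
  have l0 : nprod (eta b) (-1) (0 : W) = 0.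
    have := nprod_linearr (eta b) (-1) 1 0 0.
    by rewrite !scale1r addr0 => h; apply: (@addrI W (nprod (eta b) (-1) 0)); rewrite addr0 -h.
  by rewrite l0 addr0.
have lsum (g : W -> W) (c : 'I_n -> C) : linear g ->
    g (\sum_a c a *: eta a) = \sum_a c a *: g (eta a).
  move=> glin; pose f : {linear W -> W} :=
    HB.pack g (GRing.isLinear.Build _ _ _ _ g glin).
  by rewrite -[LHS]/(f _) linear_sum; apply: eq_bigr => a _; rewrite linearZ.
have prodE (c d : 'I_n -> C) :
    nprod (\sum_a c a *: eta a) 1 (\sum_b d b *: eta b)
    = (\sum_a \sum_b c a * d b * invmx Om a b) *: vac W.
  rewrite (lsum (fun x => nprod x 1 _)); last exact: nprod_linearl.
  rewrite scaler_suml; apply: eq_bigr => a _.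
  rewrite (lsum (nprod (eta a) 1)); last exact: nprod_linearr.
  rewrite scaler_suml scaler_sumr; apply: eq_bigr => b _.
  by rewrite ope !scalerA.
have rhoE' b : rho (eta b) = \sum_a (- 'i * Om a b) *: eta a.
  by rewrite rhoE scaler_sumr; apply: eq_bigr => a _; rewrite scalerA.
have rho0 : rho 0 = 0.
  have := conj_antilinear conjr 1 0 0; rewrite conjC1 !scale1r addr0 => h.
  by apply: (@addrI W (rho 0)); rewrite addr0 -h.
have key a b : (invmx Om a b)^* = Om b a.
  have := conj_nprod conjr 1 (sf_odd sf a) (sf_odd sf b).
  rewrite ope -[X in rho X](addr0 (_ *: vac W)) (conj_antilinear conjr) rho0 addr0.
  rewrite (conj_vac conjr) !rhoE' prodE scalerA => /eqP.
  rewrite -subr_eq0 -scalerBl scaler_eq0 (negPf vac_neq0) orbF subr_eq0 => /eqP->.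
  transitivity (\sum_c Om c a * (invmx Om *m Om) c b).
    rewrite expr1 mulN1r -sumrN; apply: eq_bigr => c _.
    rewrite mxE !mulr_sumr -sumrN; apply: eq_bigr => d _.
    have := sqrCi C; rewrite expr2 => ii.
    transitivity (- ('i * 'i) * (Om c a * (invmx Om c d * Om d b))); first by ring.
    by rewrite ii opprK mul1r.
  rewrite mulVmx // (bigD1 b) //= mxE eqxx mulr1 big1 ?addr0 // => c /negPf cb.
  by rewrite mxE cb mulr0.
apply/unitarymxP; rewrite -[RHS](mulmxV Om_unit); congr (_ *m _).
by apply/matrixP=> a b; rewrite !mxE -key conjCK.
Qed.

(* Main.v *)
Require Import Defs.
From mathcomp Require Import all_boot all_order all_algebra.
From mathcomp Require Import boolp functions ring zify.
From HB Require Import structures.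
Import Order.TTheory GRing.Theory Num.Theory.
Local Open Scope ring_scope.

(** The space Sf[V] is a fermionic Fock space: by free generation the sorted
    monomials in the creation modes eta^a_(-n-1) form a basis, and everything is
    governed by the anticommutation relations of the modes. The lemma
    [fock_universal] makes this a construction principle: operators on any
    space that anticommute like the creation modes are intertwined with them by
    a map with any given value at the vacuum. The operators s and sigma
    ([dilation]), the form ([form]) and the conjugation ([rho]) are obtained in
    this way. What is known for the generating fields is then extended to all
    fields by induction on the length of monomials, by means of the Borcherds
    identity.

    Conformal structure. Among the products of eta^c and T with nonnegative
    index only eta^c_1 T = eta^c is nonzero, so [L_m, eta^c_k] = - k eta^c_(m+k).
    Hence L_(-1) is the translation, L_0 is diagonal on monomials, and the
    commutator formula gives the Virasoro relations with central charge
    - dim V ([virasoro_stress_tensor]).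

    Form. The formula (eta^a_m u, v) = - (-1)^|u| (u, eta^a_(-m) v) holds by
    construction for creation modes and by skewness of Omega for annihilation
    modes ([form_mode]); it also determines the form. The vectors whose fields
    satisfy the invariance formula are stable under the translation
    ([invariant_vector_deriv]), by a computation with sl_2, and under
    eta^a_(-1) ([invariant_vector_creation0]), because L_1 commutes with
    eta^a_(-1). Commutators of these two kinds of operators yield all creation
    modes.

    Conjugation. Since Omega_(ab) is unitary and skew, the vectors
    - i Omega_(ab) eta^a satisfy the complex conjugates of the relations of the
    eta^b, up to the sign required for odd fields ([conj_eta_ope]). So [rho]
    exists, and it is multiplicative because the coefficients of the Borcherds
    identity are real ([rho_nprod]).

    Positivity. For the Hermitian form, the adjoint of eta^b_(-n-1) is
    Omega_(ba) eta^a_(n+1), and the anticommutator of this operator with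
    eta^c_(-m-1) is n + 1 if (b, n) = (c, m) and zero otherwise
    ([annihilation_creation]). As in any fermionic Fock space, the sorted
    monomials are then orthogonal with squared norms the products of the n_i + 1
    ([hform_mono]). The map sigma o rho squares to s and preserves the
    filtration, so positivity implies that the bilinear form is nondegenerate on
    each filtered component ([nondegenerate_theta]). *)

Set Implicit Arguments.
Unset Strict Implicit.
Unset Printing Implicit Defensive.

(** * Spans and subspaces *)

Section Spans.
Context {C : fieldType} {W : lmodType C}.
Implicit Types (P Q : W -> Prop) (x y : W).

Lemma subspaceD P x y : subspace P -> P x -> P y -> P (x + y).
Proof. by case=> _ lin Px Py; rewrite -[x]scale1r; apply: lin. Qed.

Lemma subspaceZ P a x : subspace P -> P x -> P (a *: x).
Proof. by case=> P0 lin Px; rewrite -[_ *: _]addr0; apply: lin. Qed.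

Lemma subspaceN P x : subspace P -> P x -> P (- x).
Proof. by move=> subP Px; rewrite -scaleN1r; apply: subspaceZ. Qed.

Lemma subspaceB P x y : subspace P -> P x -> P y -> P (x - y).
Proof. by move=> subP Px Py; apply: subspaceD => //; apply: subspaceN. Qed.

Lemma subspace_sum P (I : Type) (r : seq I) (S : pred I) (f : I -> W) :
  subspace P -> (forall i, S i -> P (f i)) -> P (\sum_(i <- r | S i) f i).
Proof.
move=> subP Pf; apply: (big_ind P) => //; first by case: subP.
by move=> x y; apply: subspaceD.
Qed.

Lemma lspan_ind Q P :
  subspace P -> (forall x, Q x -> P x) -> forall x, lspan Q x -> P x.
Proof.
move=> subP QP _ [m [c [y [Qy ->]]]].
by apply: subspace_sum => // i _; apply: subspaceZ => //; apply: QP.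
Qed.

Lemma mem_lspan Q x : Q x -> lspan Q x.
Proof.
move=> Qx; exists 1%N, (fun=> 1), (fun=> x).
by split=> //; rewrite big_ord1 scale1r.
Qed.

Lemma lspan_subspace Q : subspace (lspan Q).
Proof.
split=> [|a _ _ [m [c [y [Qy ->]]]] [l [d [z [Qz ->]]]]].
  by exists 0%N, (fun=> 0), (fun=> 0); split=> [[]|] //; rewrite big_ord0.
exists (m + l)%N.
exists (fun i => match fintype.split i with inl j => a * c j | inr j => d j end).
exists (fun i => match fintype.split i with inl j => y j | inr j => z j end).
split=> [i|]; first by case: (fintype.split i).
rewrite big_split_ord scaler_sumr; congr (_ + _); apply: eq_bigr => i _.
  by case: fintype.splitP => [j /= /ord_inj->|j /= ij]; rewrite ?scalerA //; have := ltn_ord i; lia.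
by case: fintype.splitP => [j /= ij|j /= /addnI/ord_inj->] //; have := ltn_ord j; lia.
Qed.

Lemma lspan_sub Q P x :
  (forall y, Q y -> P y) -> lspan Q x -> lspan P x.
Proof.
move=> QP; apply: lspan_ind; first exact: lspan_subspace.
by move=> y Qy; apply/mem_lspan/QP.
Qed.

Lemma lspan_family (I : finType) (y : I -> W) x :
  lspan (fun z => exists i, z = y i) x -> exists c : I -> C, x = \sum_i c i *: y i.
Proof.
apply: (lspan_ind (P := fun z => exists c : I -> C, z = \sum_i c i *: y i)) => [|_ [i ->]].
  split=> [|a _ _ [c ->] [d ->]].
    by exists (fun=> 0); rewrite big1 // => i _; rewrite scale0r.
  exists (fun i => a * c i + d i); rewrite scaler_sumr -big_split /=.
  by apply: eq_bigr => i _; rewrite scalerDl scalerA.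
exists (fun j => (j == i)%:R); rewrite (bigD1 i) //= eqxx scale1r big1 ?addr0 //.
by move=> j /negPf->; rewrite scale0r.
Qed.

End Spans.

Lemma linear_fun0 (C : fieldType) (U V : lmodType C) (f : U -> V) : linear f -> f 0 = 0.
Proof. by move=> lf; have := lf (-1) 0 0; rewrite scaler0 addr0 scaleN1r addNr. Qed.

(** * Consequences of the Borcherds identity *)

Section VertexAlgebraTheory.
Context {C : numClosedFieldType} {W : vertexAlgebra C}.
Implicit Types (x y z u v : W) (p q : bool) (m n k : int).

HB.instance Definition _ x n :=
  GRing.isLinear.Build C W W _ (nprod x n) (nprod_linearr x n).

HB.instance Definition _ :=
  GRing.isLinear.Build C W W _ (@Defs.deriv C W) (@deriv_linear C W).

Lemma nprod0l n y : nprod (0 : W) n y = 0.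
Proof.
have := nprod_linearl n y 1 0 0; rewrite !scale1r addr0 => h.
by apply: (@addrI W (nprod 0 n y)); rewrite addr0 -h.
Qed.

Lemma nprodZl a x n y : nprod (a *: x) n y = a *: nprod x n y.
Proof. by have := nprod_linearl n y a x 0; rewrite nprod0l !addr0. Qed.

Lemma nprodDl x y n z : nprod (x + y) n z = nprod x n z + nprod y n z.
Proof. by have := nprod_linearl n z 1 x y; rewrite !scale1r. Qed.

Lemma nprod_suml (I : Type) (r : seq I) (S : pred I) (f : I -> W) n y :
  nprod (\sum_(i <- r | S i) f i) n y = \sum_(i <- r | S i) nprod (f i) n y.
Proof.
apply: (big_morph (fun x => nprod x n y)) => [x z|]; first exact: nprodDl.
exact: nprod0l.
Qed.

Lemma par_subspace p : subspace (par W p).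
Proof. by case: (par_dec W). Qed.

Lemma gbinom0 m : gbinom C m 0 = 1.
Proof. by rewrite /gbinom big_ord0 divr1. Qed.

Lemma gbinom0l j : gbinom C 0 j.+1 = 0.
Proof. by rewrite /gbinom big_ord_recl /= subrr !mul0r. Qed.

Lemma gbinomN1 j : gbinom C (-1) j = (-1) ^+ j.
Proof.
rewrite /gbinom; have -> : \prod_(i < j) ((-1 : int) - i%:Z)%:~R = (-1) ^+ j * j`!%:R :> C.
  elim: j => [|j IH]; first by rewrite big_ord0 mul1r.
  rewrite big_ord_recr /= IH exprSr factS natrM -!mulrA; congr (_ * _).
  rewrite mulN1r mulrC -mulNr; congr (_ * _).
  have -> : -1 - j%:Z = - j.+1%:Z by lia.
  by rewrite mulrNz.
by rewrite mulfK // pnatr_eq0 -lt0n fact_gt0.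
Qed.

Lemma gbinom_conj m j : (gbinom C m j)^* = gbinom C m j.
Proof.
rewrite /gbinom rmorphM fmorphV /= rmorph_prod conjC_nat; congr (_ / _).
by apply: eq_bigr => i _; rewrite rmorph_int.
Qed.

(** The case m = 0 of the Borcherds identity. *)
Lemma nprod_iterate p q x y n k v : par W p x -> par W q y ->
  eventually (fun M => nprod (nprod x n y) k v =
    \sum_(j < M) ((-1) ^+ j * gbinom C n j) *:
      (nprod x (n - j%:Z) (nprod y (k + j%:Z) v)
       - ((-1) ^ n * (-1) ^+ (p && q)) *: nprod y (n + k - j%:Z) (nprod x j%:Z v))).
Proof.
move=> px qy; have [N HN] := borcherds v 0 n k px qy.
exists N.+1 => -[//|M] ltNM.
have := HN M.+1 (ltnW ltNM); rewrite big_ord_recl /= gbinom0 scale1r.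
have -> : 0 + k - 0%:Z = k by lia.
have -> : n + 0%:Z = n by lia.
rewrite big1 ?addr0 => [->|i _]; last by rewrite gbinom0l scale0r.
by apply: eq_bigr => i _; rewrite !add0r.
Qed.

(** The case n = 0 of the Borcherds identity. *)
Lemma nprod_commutator p q x y m k v : par W p x -> par W q y ->
  eventually (fun M => nprod x m (nprod y k v)
      - (-1) ^+ (p && q) *: nprod y k (nprod x m v)
    = \sum_(j < M) gbinom C m j *: nprod (nprod x j%:Z y) (m + k - j%:Z) v).
Proof.
move=> px qy; have [N HN] := borcherds v m 0 k px qy.
exists N.+1 => -[//|M] ltNM.
have := HN M.+1 (ltnW ltNM); rewrite [RHS]big_ord_recl /= [X in _ = _ + X]big1 => [|i _]; last first.
  by rewrite gbinom0l mulr0 scale0r.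
rewrite gbinom0 expr0 mul1r expr0z mul1r scale1r addr0 /=.
have -> : m + 0 - 0%:Z = m by lia.
have -> : k + 0%:Z = k by lia.
have -> : 0 + k - 0%:Z = k by lia.
have -> : m + 0%:Z = m by lia.
by move=> <-; apply: eq_bigr => i _; rewrite add0r.
Qed.

Lemma nprod_eventually0 x y (a : int) : eventually (fun M => nprod x (a + M%:Z) y = 0).
Proof.
have [N HN] := nprod_trunc x y; exists `|N - a|%N => M leNM; apply: HN.
by rewrite -lerBlDl; apply: le_trans (ler_norm _) _; rewrite -abszE lez_nat.
Qed.

(** For n = -1 the signed binomials in the iterate formula are all 1. Each of
    its two families of terms is finite by itself, so that they may be cut at
    different places; this leaves room for a shift of one of the indices. *)
Lemma nprod_normal_order p q x y k v : par W p x -> par W q y ->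
  exists N, forall M M', (N <= M)%N -> (N <= M')%N ->
    nprod (nprod x (-1) y) k v =
      \sum_(j < M) nprod x (- 1 - j%:Z) (nprod y (k + j%:Z) v)
      + (-1) ^+ (p && q) *:
        \sum_(j < M') nprod y (k - 1 - j%:Z) (nprod x j%:Z v).
Proof.
move=> px qy; have [N0 H0] := nprod_iterate (-1) k v px qy.
have [N1 H1] := nprod_eventually0 y v k.
have [N2 H2] := nprod_eventually0 x v 0.
have tail (f : nat -> W) N M : (forall j, (N <= j)%N -> f j = 0) -> (N <= M)%N ->
    \sum_(j < M) f j = \sum_(j < N) f j.
  move=> f0 leNM; rewrite -(subnKC leNM) big_split_ord /= [X in _ + X]big1 ?addr0 //.
  by move=> i _; apply: f0; rewrite leq_addr.
(* Beyond N1 the modes of y kill v, beyond N2 those of x do. *)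
pose N := maxn N0 (maxn N1 N2).
have [le0 [le1 le2]] : (N0 <= N)%N /\ (N1 <= N)%N /\ (N2 <= N)%N by lia.
exists N => M M' leM leM'; rewrite (tail (fun j => nprod x (- 1 - j%:Z) (nprod y (k + j%:Z) v)) N M) //; last first.
  by move=> j lej; rewrite H1 ?linear0 //; lia.
rewrite (tail (fun j => nprod y (k - 1 - j%:Z) (nprod x j%:Z v)) N M') //; last first.
  by move=> j lej; rewrite -[j%:Z]add0r H2 ?linear0 //; lia.
rewrite (H0 N) // scaler_sumr -big_split /=; apply: eq_bigr => j _.
rewrite gbinomN1 -expr2 sqrr_sign scale1r; congr (_ + _).
by rewrite exprN1 invrN1 mulN1r scaleNr opprK; congr (_ *: nprod _ _ _); ring.
Qed.

End VertexAlgebraTheory.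

Arguments par_subspace {C W}.

(** * The universal property of the Fock space *)

Section Letters.
Context {n : nat}.
Implicit Types (p q r : 'I_n * nat) (w : seq ('I_n * nat)).

Lemma mode_ltxx p : mode_lt p p = false.
Proof. by rewrite /mode_lt !ltnn andbF. Qed.

Lemma mode_lt_trans : transitive (@mode_lt n).
Proof. by move=> q p r; rewrite /mode_lt; lia. Qed.

Lemma mode_lt_total p q : p != q -> ~~ mode_lt p q -> mode_lt q p.
Proof.
rewrite /mode_lt; case: p q => [a k] [b l] /=; rewrite xpair_eqE negb_and -val_eqE /=; lia.
Qed.

Lemma sorted_mode_uniq w : sorted mode_lt w -> uniq w.
Proof. exact: (sorted_uniq mode_lt_trans mode_ltxx). Qed.

(** Insertion sort by anticommutation. The sign [e] (zero when [p] occurs in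
    [w]) and the sorted word depend on the letters only, hence are the same in
    every representation of the relations; this is what makes linear maps
    between representations well defined. The condition on [r] is the
    induction hypothesis that keeps words sorted. *)
Lemma anticommuting_insert p w : sorted mode_lt w ->
  exists (e : int) w', [/\ sorted mode_lt w',
    forall r, mode_lt r p -> path mode_lt r w -> path mode_lt r w'
  & forall (C : numClosedFieldType) (U : lmodType C) (A : 'I_n * nat -> U -> U) (u : U),
      (forall q, linear (A q)) -> (forall q r v, A q (A r v) = - A r (A q v)) ->
      A p (foldr A u w) = e%:~R *: foldr A u w'].
Proof.
elim: w => [|q w IH] sw.
  exists 1, [:: p]; split=> // [r rp _|C U A u _ _] /=; first by rewrite rp.
  by rewrite scale1r.
have [<-|npq] := eqVneq p q.
  (* [A p] anticommutes with itself, so its square is zero. *)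
  exists 0, [::]; split=> // C U A u _ anti; rewrite scale0r /=.
  have /eqP := anti p p (foldr A u w); rewrite -addr_eq0 -mulr2n -scaler_nat.
  by rewrite scaler_eq0 pnatr_eq0 => /eqP.
have [pq|/(mode_lt_total npq) qp] := boolP (mode_lt p q).
  exists 1, (p :: q :: w); split=> [|r rp _|C U A u _ _] /=; last by rewrite scale1r.
    by rewrite pq.
  by rewrite rp pq.
have [e [w' [sw' lew' IHw]]] := IH (path_sorted sw).
have qw' : path mode_lt q w' by apply: lew'.
exists (- e), (q :: w'); split=> // [r rp /= /andP[-> _] //|C U A u linA anti] /=.
rewrite anti IHw // -[_ *: _ in LHS]addr0 linA (linear_fun0 (linA q)) addr0.
by rewrite mulrNz scaleNr.
Qed.

End Letters.

Lemma big_subseq_mem (V : zmodType) (T : eqType) (s t : seq T) (f : T -> V) :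
  uniq s -> uniq t -> {subset s <= t} ->
  \sum_(w <- s) f w = \sum_(w <- t) (if w \in s then f w else 0).
Proof.
move=> us ut st; rewrite -big_mkcond -big_filter; apply: perm_big.
apply: uniq_perm => [||w]; rewrite ?filter_uniq // mem_filter.
by case: (boolP (w \in s)) => // /st ->.
Qed.

Section FockSpace.
Context {C : numClosedFieldType} {n : nat} {Om : 'M[C]_n}.
Context {W : vertexAlgebra C} {eta : 'I_n -> W}.
Hypothesis sf : symplectic_fermions Om eta.
Local Notation letter := ('I_n * nat)%type.
Local Notation mono := (monomial eta).
Implicit Types (x y z u v : W) (p q : letter) (w : seq letter) (s t : seq (seq letter)).

Lemma expansion x : exists sc : seq (seq letter) * (seq letter -> C),
  [/\ uniq sc.1, all (sorted mode_lt) sc.1 & x = \sum_(w <- sc.1) sc.2 w *: mono w].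
Proof.
apply: (lspan_ind (P := fun x => exists sc : seq (seq letter) * (seq letter -> C),
  [/\ uniq sc.1, all (sorted mode_lt) sc.1 & x = \sum_(w <- sc.1) sc.2 w *: mono w]))
  (sf_span sf x) => [|_ [w [sw ->]]]; last first.
  by exists ([:: w], fun=> 1); split=> //=; rewrite ?sw // big_seq1 scale1r.
split=> [|a _ _ [[s c] [/= us ss ->]] [[t d] [/= ut st ->]]].
  by exists ([::], fun=> 0); split=> //; rewrite big_nil.
exists (undup (s ++ t), fun w => a * (if w \in s then c w else 0) + (if w \in t then d w else 0)).
split=> /=; first exact: undup_uniq.
  apply/allP=> w; rewrite mem_undup mem_cat => /orP[]; [exact: allP ss w | exact: allP st w].
rewrite (big_subseq_mem _ us (undup_uniq (s ++ t))); last first.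
  by move=> w ws; rewrite mem_undup mem_cat ws.
rewrite [X in _ + X](big_subseq_mem _ ut (undup_uniq (s ++ t))); last first.
  by move=> w wt; rewrite mem_undup mem_cat wt orbT.
rewrite scaler_sumr -big_split /=; apply: eq_bigr => w _.
by rewrite scalerDl -scalerA; do 2 case: ifP => _; rewrite ?scale0r ?scaler0.
Qed.

Definition supp x : seq (seq letter) := (projT1 (cid (expansion x))).1.

Definition coef x w : C :=
  if w \in supp x then (projT1 (cid (expansion x))).2 w else 0.

Lemma supp_uniq x : uniq (supp x).
Proof. by rewrite /supp; case: cid => ? []. Qed.

Lemma supp_sorted x w : w \in supp x -> sorted mode_lt w.
Proof. by move: w; apply/allP; rewrite /supp; case: cid => ? []. Qed.

Lemma coef_out x w : w \notin supp x -> coef x w = 0.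
Proof. by rewrite /coef => /negPf->. Qed.

Lemma coefE x : x = \sum_(w <- supp x) coef x w *: mono w.
Proof.
rewrite {1}(_ : x = \sum_(w <- supp x) (projT1 (cid (expansion x))).2 w *: mono w).
  by apply: eq_big_seq => w ws; rewrite /coef ws.
by rewrite /supp; case: cid => ? [].
Qed.

Lemma supp_widen (V : lmodType C) (h : C -> C) (g : seq letter -> V) x t :
  h 0 = 0 -> uniq t -> {subset supp x <= t} ->
  \sum_(w <- supp x) h (coef x w) *: g w = \sum_(w <- t) h (coef x w) *: g w.
Proof.
move=> h0 ut st; rewrite (big_subseq_mem _ (supp_uniq x) ut st).
by apply: eq_bigr => w _; case: ifPn => // /coef_out->; rewrite h0 scale0r.
Qed.

Lemma coef_unique t (d : seq letter -> C) x : uniq t -> all (sorted mode_lt) t ->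
  x = \sum_(w <- t) d w *: mono w -> forall w, coef x w = if w \in t then d w else 0.
Proof.
move=> ut st xE w; pose r := undup (supp x ++ t).
have ur : uniq r by apply: undup_uniq.
have sr : all (sorted mode_lt) r.
  apply/allP=> w'; rewrite mem_undup mem_cat => /orP[/supp_sorted //|]; exact: allP st w'.
have /= := sf_free sf (s := r) (c := fun w => coef x w - if w \in t then d w else 0) ur sr.
move=> free; have [wr|] := boolP (w \in r); last first.
  by rewrite mem_undup mem_cat negb_or => /andP[/coef_out-> /negPf->].
apply/eqP; rewrite -subr_eq0; apply/eqP/free => //.
under eq_bigr do rewrite scalerBl; rewrite sumrB.
rewrite -(supp_widen (h := id)) //; last by move=> w'; rewrite mem_undup mem_cat => ->.
rewrite -coefE {1}xE (big_subseq_mem _ ut ur); last first.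
  by move=> w' w't; rewrite mem_undup mem_cat w't orbT.
by rewrite -sumrB big1 // => w' _; case: ifP => _; rewrite ?scale0r ?subrr.
Qed.

Lemma coef_linear a x y w : coef (a *: x + y) w = a * coef x w + coef y w.
Proof.
pose t := undup (supp x ++ supp y).
rewrite (coef_unique (t := t) (d := fun w => a * coef x w + coef y w)).
- case: ifPn => //; rewrite mem_undup mem_cat negb_or => /andP[].
  by move=> /coef_out-> /coef_out->; rewrite mulr0 addr0.
- exact: undup_uniq.
- by apply/allP=> w'; rewrite mem_undup mem_cat => /orP[] /supp_sorted.
have ut : uniq t by apply: undup_uniq.
rewrite {1}[x]coefE {1}[y]coefE (supp_widen (h := id) _ _ ut) //; last first.
  by move=> w'; rewrite mem_undup mem_cat => ->.
rewrite (supp_widen (h := id) _ _ ut) //; last first.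
  by move=> w'; rewrite mem_undup mem_cat orbC => ->.
by rewrite scaler_sumr -big_split; apply: eq_bigr => w' _; rewrite scalerDl scalerA.
Qed.

Lemma coef_mono w w' : sorted mode_lt w -> coef (mono w) w' = (w' == w)%:R.
Proof.
move=> sw; rewrite (coef_unique (t := [:: w]) (d := fun=> 1)) //= ?sw //.
  by rewrite inE; case: eqP.
by rewrite big_seq1 scale1r.
Qed.

(** The twist [tau] makes room for antilinear maps. *)
Lemma linear_extension (tau : {rmorphism C -> C}) (U : lmodType C) (g : seq letter -> U) :
  exists f : W -> U, (forall a x y, f (a *: x + y) = tau a *: f x + f y) /\
    (forall w, sorted mode_lt w -> f (mono w) = g w).
Proof.
exists (fun x => \sum_(w <- supp x) tau (coef x w) *: g w); split=> [a x y|w sw].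
  pose t := undup (supp (a *: x + y) ++ supp x ++ supp y).
  have ut : uniq t by apply: undup_uniq.
  rewrite !(supp_widen _ (t := t)) ?rmorph0 //;
    try by move=> w wx; rewrite mem_undup !mem_cat wx ?orbT.
  rewrite scaler_sumr -big_split; apply: eq_bigr => w _ /=.
  by rewrite coef_linear rmorphD rmorphM scalerDl scalerA.
rewrite (supp_widen _ (t := undup (w :: supp (mono w)))) ?rmorph0 ?undup_uniq //; last first.
  by move=> w' ws; rewrite mem_undup inE ws orbT.
rewrite (bigD1_seq w) ?undup_uniq ?mem_undup ?mem_head //= coef_mono // eqxx rmorph1 scale1r.
by rewrite big1 ?addr0 // => w' /negPf ww'; rewrite coef_mono // ww' rmorph0 scale0r.
Qed.

Definition creation p x : W := nprod (eta p.1) (- p.2%:Z - 1) x.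

Lemma creation_linear p : linear (creation p).
Proof. exact: nprod_linearr. Qed.

HB.instance Definition _ p :=
  GRing.isLinear.Build C W W _ (creation p) (creation_linear p).

Lemma monomial_cons p w : mono (p :: w) = creation p (mono w).
Proof. by []. Qed.

Lemma creation_anti p q x : creation p (creation q x) = - creation q (creation p x).
Proof.
apply/eqP; rewrite -addr_eq0; apply/eqP; rewrite (sf_ope sf).
by rewrite (_ : _ == 0 = false) ?scale0r //; lia.
Qed.

(** The Fock space is the free module with one generator over the exterior
    algebra of the creation modes. Values are prescribed on the basis of sorted
    monomials; [anticommuting_insert], applied on both sides, shows that the
    resulting map intertwines the operators. *)
Lemma fock_universal (tau : {rmorphism C -> C}) (U : lmodType C)
    (A : letter -> U -> U) (u0 : U) :
  (forall p, linear (A p)) -> (forall p q (a : U), A p (A q a) = - A q (A p a)) ->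
  exists f : W -> U, [/\ forall a x y, f (a *: x + y) = tau a *: f x + f y,
    f (vac W) = u0 & forall p x, f (creation p x) = A p (f x)].
Proof.
move=> linA antiA.
have [f [flin fmono]] := linear_extension tau (foldr A u0).
have f0 : f 0 = 0.
  by have := flin (-1) 0 0; rewrite scaler0 addr0 rmorphN1 scaleN1r addNr.
have A0 p : A p 0 = 0 by apply: linear_fun0.
exists f; split=> // [|p x]; first exact: (fmono [::]).
apply: (lspan_ind (P := fun x => f (creation p x) = A p (f x))) (sf_span sf x) => [|_ [w [sw ->]]].
  split=> [|a y z Hy Hz]; first by rewrite linear0 f0 A0.
  by rewrite linearP !flin Hy Hz linA.
have [e [w' [sw' _ ins]]] := anticommuting_insert p sw.
rewrite fmono // ins // -[creation p _]/(creation p (foldr creation (vac W) w)) ins.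
- by rewrite -[X in f X]addr0 flin f0 addr0 fmono // rmorph_int.
- exact: creation_linear.
- exact: creation_anti.
Qed.

Lemma fock_ind (P : W -> Prop) : subspace P -> (forall w, P (mono w)) -> forall x, P x.
Proof. by move=> subP Pm x; apply: lspan_ind (sf_span sf x) => // _ [w [_ ->]]. Qed.

End FockSpace.

(** * The Virasoro action *)

Section StressTensor.
Context {C : numClosedFieldType} {n : nat} {Om : 'M[C]_n}.
Context {W : vertexAlgebra C} {eta : 'I_n -> W}.
Hypothesis sf : symplectic_fermions Om eta.
Local Notation letter := ('I_n * nat)%type.
Local Notation mono := (monomial eta).
Local Notation iOm := (invmx Om).
Local Notation creation := (creation (eta := eta)).
Local Notation T := (stress_tensor Om eta).
Implicit Types (x y z u v : W) (p q : letter) (w : seq letter) (a b c : 'I_n) (k l m : int).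

Lemma fock_rect (P : W -> Prop) : subspace P -> P (vac W) ->
  (forall p x, P x -> P (creation p x)) -> forall x, P x.
Proof.
by move=> subP Pv Pc; apply: (fock_ind sf) => //; elim=> // p w; apply: Pc.
Qed.

Lemma mode_creation a k p x : nprod (eta a) k (creation p x) =
  (if k == p.2.+1 then k%:~R * iOm a p.1 else 0) *: x - creation p (nprod (eta a) k x).
Proof.
apply: (canRL (addrK _)); rewrite (sf_ope sf).
by congr (_ *: _); rewrite (_ : (k + _ == 0) = (k == p.2.+1)) //; lia.
Qed.

Lemma mode_vac a k : 0 <= k -> nprod (eta a) k (vac W) = 0.
Proof. exact: nprod_vacr. Qed.

Lemma mode_zero a x : nprod (eta a) 0 x = 0.
Proof.
elim/fock_rect: x => [||p x IH]; [|exact: mode_vac|].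
  split=> [|c y z Hy Hz]; first exact: linear0.
  by rewrite linearP /= Hy Hz scaler0 addr0.
by rewrite mode_creation IH linear0 subr0 /= scale0r.
Qed.

Lemma etaE b : eta b = creation (b, 0%N) (vac W).
Proof. by rewrite /creation oppr0 add0r nprod_create. Qed.

Hypothesis Om_unit : Om \in unitmx.
Hypothesis Om_skew : forall a b, Om b a = - Om a b.

Lemma sum_Om_iOm a c : \sum_b Om a b * iOm b c = (a == c)%:R.
Proof. by have /matrixP/(_ a c) := mulmxV Om_unit; rewrite !mxE. Qed.

Lemma sum_iOm_Om a c : \sum_b iOm a b * Om b c = (a == c)%:R.
Proof. by have /matrixP/(_ a c) := mulVmx Om_unit; rewrite !mxE. Qed.

Lemma iOm_skew a b : iOm b a = - iOm a b.
Proof.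
have OmT : Om^T = - Om by apply/matrixP=> i j; rewrite !mxE Om_skew.
have /matrixP/(_ a b) : (iOm)^T = - iOm.
  rewrite trmx_inv OmT -!scaleN1r invmxZ ?invrN1 //.
  by rewrite scaleN1r -OmT unitmx_tr.
by rewrite !mxE.
Qed.

Lemma stress_tensorE :
  T = 2%:R^-1 *: \sum_a \sum_b Om a b *: creation (a, 0%N) (creation (b, 0%N) (vac W)).
Proof.
congr (_ *: _); apply: eq_bigr => a _; apply: eq_bigr => b _; rewrite -etaE.
by rewrite /creation /= oppr0 add0r.
Qed.

Lemma par_stress_tensor : par W false T.
Proof.
apply: (subspaceZ _ (par_subspace false)).
do 2 apply: subspace_sum (par_subspace false) _ => ? _.
by apply: (subspaceZ _ (par_subspace false)); apply: (par_nprod (p := true) (q := true)); apply: sf_odd sf _.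
Qed.

(** The contractions of [eta c] with the two factors of T agree because [Om]
    and its inverse are both skew; this cancels the factor 1/2. *)
Lemma mode_stress_tensor c k : 0 <= k -> nprod (eta c) k T = if k == 1 then eta c else 0.
Proof.
move=> k0; rewrite stress_tensorE linearZ linear_sum /=.
have E a b : nprod (eta c) k (creation (a, 0%N) (creation (b, 0%N) (vac W))) =
    if k == 1 then iOm c a *: eta b - iOm c b *: eta a else 0.
  rewrite !mode_creation mode_vac //= linear0 subr0 -!etaE.
  case: eqP => [->|_]; last by rewrite !scale0r linear0 subr0.
  by rewrite !mul1r linearZ /= -etaE.
under eq_bigr => a _.
  rewrite linear_sum /=; under eq_bigr do rewrite linearZ /= E.
  over.
case: eqP => _; last by rewrite big1 ?scaler0 // => a _; rewrite big1 // => b _; rewrite scaler0.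
have S1 : \sum_a \sum_b (Om a b * iOm c a) *: eta b = eta c.
  rewrite exchange_big /= (bigD1 c) //= [X in _ + X]big1 => [|b bc].
    rewrite -scaler_suml; under eq_bigr do rewrite mulrC.
    by rewrite sum_iOm_Om eqxx scale1r addr0.
  rewrite -scaler_suml; under eq_bigr do rewrite mulrC.
  by rewrite sum_iOm_Om eq_sym (negPf bc) scale0r.
have S2 : \sum_a \sum_b (Om a b * iOm c b) *: eta a = - eta c.
  rewrite -[in RHS]S1 exchange_big /= -sumrN; apply: eq_bigr => a _.
  rewrite -sumrN; apply: eq_bigr => b _.
  by rewrite Om_skew mulNr scaleNr.
under eq_bigr => a _.
  under eq_bigr do rewrite scalerBr !scalerA.
  rewrite sumrB; over.
by rewrite sumrB S1 S2 opprK -mulr2n -scaler_nat scalerA mulVf ?scale1r ?pnatr_eq0.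
Qed.

Lemma gbinom1 m : gbinom C m 1 = m%:~R.
Proof. by rewrite /gbinom big_ord1 subr0 divr1. Qed.

Lemma Lmode_linear m : linear (Lmode T m : W -> W).
Proof. exact: nprod_linearr. Qed.

HB.instance Definition _ m := GRing.isLinear.Build C W W _ (Lmode T m) (Lmode_linear m).

(** The field [eta a] is primary of weight 1: by [mode_stress_tensor] only the
    first-order pole contributes to the commutator formula. *)
Lemma Lmode_mode m a k x :
  Lmode T m (nprod (eta a) k x) = nprod (eta a) k (Lmode T m x) - k%:~R *: nprod (eta a) (m + k) x.
Proof.
have [N] := nprod_commutator k (m + 1) x (sf_odd sf a) par_stress_tensor.
move=> /(_ N.+2 (leqW (leqnSn N))); rewrite expr0 scale1r => E.
rewrite -[LHS](subKr (nprod (eta a) k (Lmode T m x))) {}E; congr (_ - _).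
rewrite !big_ord_recl /= !mode_stress_tensor // [X in _ + (_ + X)]big1 => [|j _]; last first.
  by rewrite mode_stress_tensor // nprod0l scaler0.
rewrite nprod0l scaler0 add0r addr0 gbinom1; congr (_ *: nprod _ _ _).
by rewrite /bump /=; lia.
Qed.

Lemma Lmode_creation m p x : Lmode T m (creation p x) =
  creation p (Lmode T m x) + p.2.+1%:R *: nprod (eta p.1) (m - p.2%:Z - 1) x.
Proof.
rewrite Lmode_mode -scaleNr; congr (_ + _ *: nprod _ _ _); last by ring.
have -> : - p.2%:Z - 1 = - p.2.+1%:Z by lia.
by rewrite mulrNz opprK.
Qed.

Lemma Lmode_vac m : -1 <= m -> Lmode T m (vac W) = 0.
Proof. by move=> m1; apply: nprod_vacr; rewrite -(addNr 1) lerD2r. Qed.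

(** Both sides kill the vacuum and have the same commutator with every
    creation mode. *)
Lemma Lmode_deriv x : Lmode T (-1) x = Defs.deriv x.
Proof.
elim/fock_rect: x => [||p x IH]; last 1 first.
- rewrite Lmode_creation IH /creation.
  have /eqP := deriv_nprod (eta p.1) (- p.2%:Z - 1) x; rewrite subr_eq => /eqP->.
  rewrite addrC; congr (_ *: nprod _ _ _ + _); last by ring.
  have -> : - p.2%:Z - 1 = - p.2.+1%:Z by lia.
  by rewrite mulrNz opprK.
- split=> [|c y z Hy Hz]; first by rewrite !linear0.
  by rewrite !linearP /= Hy Hz.
by rewrite Lmode_vac // deriv_vac.
Qed.

(** The translation is the zero mode T_0, so that the commutator formula
    identifies the field of the derivative with [T_0, x_k], which
    [deriv_nprod] computes. *)
Lemma deriv_nprodl (e : bool) x k y : par W e x -> nprod (Defs.deriv x) k y = - k%:~R *: nprod x (k - 1) y.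
Proof.
move=> px; rewrite -deriv_nprod -!Lmode_deriv /Lmode /=.
have [N] := nprod_commutator 0 k y par_stress_tensor px.
move=> /(_ N.+1 (leqnSn N)); rewrite big_ord_recl big1 /= => [|i _]; last first.
  by rewrite gbinom0l scale0r.
by rewrite gbinom0 !scale1r addr0 add0r subr0 addNr => ->.
Qed.

Definition wt w : nat := \sum_(p <- w) p.2.+1.

Lemma wt_cons p w : wt (p :: w) = (p.2.+1 + wt w)%N.
Proof. by rewrite /wt big_cons. Qed.

Lemma Lmode0_mono w : Lmode T 0 (mono w) = (wt w)%:R *: mono w.
Proof.
elim: w => [|p w IH]; first by rewrite Lmode_vac // /wt big_nil scale0r.
rewrite !monomial_cons Lmode_creation IH linearZ /= wt_cons natrD scalerDl addrC.
by rewrite /creation sub0r.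
Qed.

Lemma weight_mono w : weight T (2 * (wt w)%:Z) (mono w).
Proof.
rewrite /weight Lmode0_mono rmorphM /= mulrC mulKf //.
by rewrite pnatr_eq0.
Qed.

(** L_m acts on each of the two factors of T; the products T_j T that enter
    the Virasoro relations are read off from this. *)
Lemma Lmode_stress_tensor m : -1 <= m -> Lmode T m T =
  2%:R^-1 *: \sum_a \sum_b Om a b *:
    (nprod (eta a) (m - 1) (eta b) + creation (a, 0%N) (nprod (eta b) (m - 1) (vac W))).
Proof.
move=> m1; rewrite {2}stress_tensorE linearZ linear_sum /=; congr (_ *: _).
apply: eq_bigr => a _; rewrite linear_sum; apply: eq_bigr => b _; rewrite linearZ /=.
congr (_ *: _); rewrite 2!Lmode_creation Lmode_vac // linear0 add0r linearZ /=.
by rewrite !scale1r addrC subr0 -etaE.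
Qed.

Lemma Lmode0_stress_tensor : Lmode T 0 T = 2%:R *: T.
Proof.
rewrite Lmode_stress_tensor // /stress_tensor scalerA mulrC -scalerA; congr (_ *: _).
rewrite scaler_sumr; apply: eq_bigr => a _; rewrite scaler_sumr; apply: eq_bigr => b _.
rewrite scalerA mulrC -scalerA; congr (_ *: _).
by rewrite scaler_nat mulr2n sub0r nprod_create; congr (_ + _); rewrite /creation oppr0 add0r.
Qed.

Lemma Lmode1_stress_tensor : Lmode T 1 T = 0.
Proof.
rewrite Lmode_stress_tensor // big1 ?scaler0 // => a _; rewrite big1 // => b _.
by rewrite subrr !mode_zero linear0 addr0 scaler0.
Qed.

Lemma Lmode2_stress_tensor : Lmode T 2 T = (- n%:R / 2%:R) *: vac W.
Proof.
rewrite Lmode_stress_tensor //.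
under eq_bigr => a _.
  under eq_bigr => b _.
    rewrite mode_vac // linear0 addr0 (etaE b) mode_creation mode_vac // linear0 subr0 /=.
    rewrite mul1r scalerA iOm_skew mulrN; over.
  rewrite -scaler_suml sumrN sum_Om_iOm eqxx; over.
rewrite -scaler_suml scalerA sumr_const card_ord mulrC; congr (_ / _ *: _).
by rewrite mulNrn.
Qed.

Lemma Lmode3_stress_tensor m : 3 <= m -> Lmode T m T = 0.
Proof.
move=> m3; rewrite Lmode_stress_tensor ?(le_trans _ m3) //.
rewrite big1 ?scaler0 // => a _; rewrite big1 // => b _.
rewrite mode_vac ?linear0 ?addr0; last by lia.
rewrite [eta b]etaE mode_creation mode_vac ?linear0 ?subr0; last by lia.
by rewrite (_ : _ == _ = false) ?scale0r ?addr0 ?scaler0 //; apply/negbTE; rewrite /=; lia.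
Qed.

(** By the commutator formula with T_0 T the derivative of T, T_1 T = 2 T,
    T_2 T = 0, T_3 T = - n / 2 times the vacuum and T_j T = 0 for larger j. The
    central charge is minus the dimension of V: it is the trace of [Om] against
    its inverse, with the sign of the transposition. *)
Lemma virasoro_stress_tensor : virasoro T (- n%:R).
Proof.
move=> m k x; rewrite /Lmode.
have [N] := nprod_commutator (m + 1) (k + 1) x par_stress_tensor par_stress_tensor.
move=> /(_ N.+4 (leqW (leqW (leqW (leqnSn N))))); rewrite expr0 scale1r => ->.
rewrite !big_ord_recl /= [X in _ + (_ + (_ + (_ + X)))]big1 => [|j _]; last first.
  have /Lmode3_stress_tensor : 3 <= j%:Z + 3 by lia.
  rewrite /Lmode (_ : j%:Z + 3 + 1 = bump 0 (bump 0 (bump 0 (bump 0 j)))) => [->|].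
    by rewrite nprod0l scaler0.
  by rewrite /bump; lia.
rewrite (_ : nprod T 0%N T = Defs.deriv T); last by rewrite -Lmode_deriv.
rewrite (_ : nprod T (bump 0 0) T = 2%:R *: T); last by rewrite -Lmode0_stress_tensor.
rewrite (_ : nprod T (bump 0 (bump 0 0)) T = 0); last by rewrite -Lmode1_stress_tensor.
rewrite (_ : nprod T (bump 0 (bump 0 (bump 0 0))) T = (- n%:R / 2%:R) *: vac W); last first.
  by rewrite -Lmode2_stress_tensor.
rewrite nprod0l scaler0 add0r addr0 gbinom0 scale1r gbinom1 (nprodZl 2%:R) (nprodZl (- n%:R / 2%:R)) nprod_vacl.
rewrite (deriv_nprodl _ _ par_stress_tensor).
rewrite addr0 addrA; congr (_ + _).
  rewrite (_ : m + 1 + (k + 1) - 1 = m + k + 1); last by lia.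
  rewrite scalerA -scalerDl; congr (_ *: _).
  have -> : 2%:R = (2 : int)%:~R :> C by [].
  rewrite -rmorphM -rmorphN -rmorphD /=; congr (_%:~R); lia.
rewrite (_ : (_ == -1) = (m + k == 0)); last by rewrite /bump; lia.
case: eqP => _; last by rewrite !scaler0 scale0r.
rewrite scalerA; congr (_ *: _).
rewrite /gbinom !big_ord_recl big_ord0 /= mulr1 !factS fact0.
have -> : (m ^+ 3 - m)%:~R = (m + 1)%:~R * (m%:~R * (m - 1)%:~R) :> C.
  by rewrite -!rmorphM; congr (_%:~R); ring.
have -> : m + 1 - 0%N%:Z = m + 1 by lia.
have -> : m + 1 - (bump 0 0)%:Z = m by rewrite /bump; lia.
have -> : m + 1 - (bump 0 (bump 0 0))%:Z = m - 1 by rewrite /bump; lia.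
have two0 : 2%:R != 0 :> C by rewrite pnatr_eq0.
have three0 : 3%:R != 0 :> C by rewrite pnatr_eq0.
have twelve0 : 12%:R != 0 :> C by rewrite pnatr_eq0.
rewrite -[((bump 0 (bump 0 0)).+1 * _)%N]/6%N. by field; rewrite ?two0 ?three0 ?twelve0 ?pnatr_eq0.
Qed.

End StressTensor.

(** * Parity, weight and filtration *)

Section Gradings.
Context {C : numClosedFieldType} {n : nat} {Om : 'M[C]_n}.
Context {W : vertexAlgebra C} {eta : 'I_n -> W}.
Hypothesis sf : symplectic_fermions Om eta.
Local Notation letter := ('I_n * nat)%type.
Local Notation mono := (monomial eta).
Local Notation creation := (creation (eta := eta)).
Local Notation fock_rect := (fock_rect sf).
Implicit Types (x y z u v : W) (p q : letter) (w : seq letter) (a b c : 'I_n) (k l m : int).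

Lemma dilation_spec (t : C) : exists f : W -> W, [/\ linear f, f (vac W) = vac W
  & forall p x, f (creation p x) = t *: creation p (f x)].
Proof.
have [||f [flin fv fc]] :=
  fock_universal sf idfun (U := W) (A := fun p x => t *: creation p x) (vac W).
- by move=> p a x y; rewrite linearP scalerDr !scalerA mulrC.
- by move=> p q x; rewrite !linearZ /= (creation_anti sf) !scalerN.
by exists f.
Qed.

(** The operator t^l on Sf[V]_(l/2): the Grassmann parity s for t = -1 and
    sigma for t = i. *)
Definition dilation t : W -> W := projT1 (cid (dilation_spec t)).

Lemma dilation_linear t : linear (dilation t).
Proof. by rewrite /dilation; case: cid => f []. Qed.

HB.instance Definition _ t := GRing.isLinear.Build C W W _ (dilation t) (dilation_linear t).

Lemma dilation_vac t : dilation t (vac W) = vac W.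
Proof. by rewrite /dilation; case: cid => f []. Qed.

Lemma dilation_creation t p x : dilation t (creation p x) = t *: creation p (dilation t x).
Proof. by rewrite /dilation; case: cid => f []. Qed.

Lemma dilation_mono t w : dilation t (mono w) = t ^+ size w *: mono w.
Proof.
elim: w => [|p w IH]; first by rewrite dilation_vac scale1r.
by rewrite monomial_cons dilation_creation IH linearZ scalerA -exprS.
Qed.

Lemma subspace_eq (V : lmodType C) (f g : W -> V) :
  linear f -> linear g -> subspace (fun x => f x = g x).
Proof.
move=> lf lg.
by split=> [|a x y Ex Ey]; [rewrite !linear_fun0 | rewrite lf lg Ex Ey].
Qed.

Lemma dilationM t t' x : dilation t (dilation t' x) = dilation (t * t') x.
Proof.
elim/(fock_ind sf): x => [|w]; last by rewrite dilation_mono linearZ /= !dilation_mono scalerA mulrC exprMn.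
by apply: subspace_eq => c y z; rewrite !linearP.
Qed.

Lemma dilation1 x : dilation 1 x = x.
Proof.
elim/(fock_ind sf): x => [|w]; last by rewrite dilation_mono expr1n scale1r.
by apply: (subspace_eq (g := id)) => c y z; rewrite ?linearP.
Qed.

(** A mode with nonnegative index removes one letter, hence the factor t is on
    the other side than in [dilation_creation]. *)
Lemma dilation_annihilation t a k x : 0 <= k ->
  t *: dilation t (nprod (eta a) k x) = nprod (eta a) k (dilation t x).
Proof.
move=> k0; elim/fock_rect: x => [||p x IH].
- by apply: subspace_eq => c y z; rewrite !linearP //= scalerDr !scalerA mulrC.
- by rewrite mode_vac // dilation_vac mode_vac // !linear0.
rewrite dilation_creation linearZ /= !(mode_creation sf) [dilation t (_ - _)]linearB /=.
by rewrite [dilation t (_ *: x)]linearZ /= dilation_creation -[t *: creation p _]linearZ /= IH.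
Qed.

Definition parity : W -> W := dilation (-1).

HB.instance Definition _ := GRing.Linear.on parity.

Lemma parityK : involutive parity.
Proof. by move=> x; rewrite /parity dilationM mulrNN mulr1 dilation1. Qed.

Lemma parity_dilation t x : parity (dilation t x) = dilation t (parity x).
Proof. by rewrite /parity !dilationM mulrC. Qed.

Lemma parity_creation p x : parity (creation p x) = - creation p (parity x).
Proof. by rewrite /parity dilation_creation scaleN1r. Qed.

Lemma parity_vac : parity (vac W) = vac W.
Proof. exact: dilation_vac. Qed.

Lemma mode_neg a k x : k < 0 -> nprod (eta a) k x = creation (a, `|k|.-1) x.
Proof. by move=> k0; rewrite /creation /=; congr (nprod _ _ _); lia. Qed.

Lemma parity_mode a k x : parity (nprod (eta a) k x) = - nprod (eta a) k (parity x).
Proof.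
have [k0|k0] := lerP 0 k; last by rewrite !mode_neg // parity_creation.
by rewrite -dilation_annihilation // scaleN1r opprK.
Qed.

Lemma par_mono w : par W (odd (size w)) (mono w).
Proof.
elim: w => [|p w IH]; first exact: par_vac.
by rewrite [odd _]/= -[~~ _]addTb; apply: par_nprod => //; apply: sf_odd sf _.
Qed.

Definition parity_span (e : bool) : W -> Prop :=
  lspan (fun y => exists w, odd (size w) = e /\ y = mono w).

Lemma parity_span_par e x : parity_span e x -> par W e x.
Proof. by apply: lspan_ind => [|_ [w [<- ->]]]; [exact: par_subspace | exact: par_mono]. Qed.

Lemma parity_span_decomposition x :
  exists x0 x1, [/\ parity_span false x0, parity_span true x1 & x = x0 + x1].
Proof.
have sub e := lspan_subspace (fun y => exists w, odd (size w) = e /\ y = mono w).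
elim/(fock_ind sf): x => [|w].
  split=> [|a _ _ [x0 [x1 [Hx0 Hx1 ->]]] [y0 [y1 [Hy0 Hy1 ->]]]].
    by exists 0, 0; rewrite addr0; split=> //; [case: (sub false) | case: (sub true)].
  exists (a *: x0 + y0), (a *: x1 + y1).
  split; [exact: (sub false).2 | exact: (sub true).2 | by rewrite scalerDr addrACA].
have mw : parity_span (odd (size w)) (mono w) by apply: mem_lspan; exists w.
case E: (odd (size w)) in mw.
  by exists 0, (mono w); rewrite add0r; split=> //; case: (sub false).
by exists (mono w), 0; rewrite addr0; split=> //; case: (sub true).
Qed.

(** The monomials of either length parity span a subspace of the matching
    Grassmann parity, and the two together span everything. *)
Lemma par_parity_span e x : par W e x -> parity_span e x.
Proof.
have [_ _ disj] := par_dec W.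
have [x0 [x1 [Hx0 Hx1 ->]]] := parity_span_decomposition x.
have := parity_span_par Hx0; have := parity_span_par Hx1; case: e => P1 P0 P.
  rewrite (disj x0) ?add0r //; rewrite -[x0](addrK x1).
  exact: subspaceB (par_subspace true) P P1.
rewrite (disj x1) ?addr0 //; rewrite -[x1](addKr x0) addrC.
exact: subspaceB (par_subspace false) P P0.
Qed.

Lemma parity_par e x : par W e x -> parity x = (-1) ^+ e *: x.
Proof.
move/par_parity_span.
apply: (lspan_ind (P := fun x => parity x = (-1) ^+ e *: x)) => [|_ [w [<- ->]]].
  by apply: subspace_eq => c y z; rewrite ?linearP // scalerDr !scalerA mulrC.
by rewrite /parity dilation_mono signr_odd.
Qed.

Lemma par_parity e x : par W e x -> par W e (parity x).
Proof. by move=> px; rewrite (parity_par px); apply: subspaceZ (par_subspace e) px. Qed.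

Lemma Sf_Z2E e x : Sf_Z2 eta e x <-> par W e x.
Proof.
split=> [|/par_parity_span].
  apply: lspan_ind; first exact: par_subspace.
  move=> y [l [<-]]; apply: (lspan_ind (P := par W (odd l))) => [|_ [w [[<-] ->]]]; first exact: par_subspace.
  exact: par_mono.
apply: lspan_sub => _ [w [<- ->]]; exists (size w); split=> //.
by apply: mem_lspan; exists w.
Qed.

Lemma Z2_graded_Sf_Z2 : Z2_graded (Sf_Z2 eta).
Proof.
have [sub dec disj] := par_dec W; split; first split.
- move=> e; split=> [|a x y /Sf_Z2E Px /Sf_Z2E Py]; apply/Sf_Z2E; first by case: (sub e).
  by case: (sub e) => _; apply.
- by move=> x; have [x0 [x1 [? ? ?]]] := dec x; exists x0, x1; split=> //; apply/Sf_Z2E.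
- by move=> x /Sf_Z2E Px /Sf_Z2E; apply: disj.
by move=> a b x y k /Sf_Z2E Px /Sf_Z2E Py; apply/Sf_Z2E/par_nprod.
Qed.

(** Since the sorted monomials are independent, the equation f x = e x can be
    compared coefficientwise. *)
Lemma coef_eigen (f : W -> W) (d : seq letter -> C) (e : C) x w : linear f ->
  (forall w', sorted mode_lt w' -> f (mono w') = d w' *: mono w') ->
  f x = e *: x -> sorted mode_lt w -> coef sf x w != 0 -> d w = e.
Proof.
move=> lf fm fx sw cw.
have coef0 w' : coef sf 0 w' = 0.
  by have := coef_linear sf 1 0 0 w'; rewrite scaler0 addr0 mul1r => h;
     apply: (@addrI C (coef sf 0 w')); rewrite addr0 -h.
have cZ (e0 : C) y : coef sf (e0 *: y) w = e0 * coef sf y w.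
  by rewrite -[_ *: _]addr0 coef_linear coef0 addr0.
have : coef sf (f x) w = d w * coef sf x w.
  apply: (lspan_ind (P := fun x => coef sf (f x) w = d w * coef sf x w)) (sf_span sf x).
    split=> [|c y z Hy Hz].
      by rewrite linear_fun0 // coef0 mulr0.
    by rewrite lf !coef_linear Hy Hz mulrDr mulrCA.
  move=> _ [w' [sw' ->]]; rewrite fm // cZ coef_mono //.
  by case: eqP => [->|]; rewrite ?mulr0.
by rewrite fx cZ => /(mulIf cw).
Qed.

Section WithStressTensor.
Hypothesis Om_unit : Om \in unitmx.
Hypothesis Om_skew : forall a b, Om b a = - Om a b.
Local Notation T := (stress_tensor Om eta).

Lemma weight_coef k x w :
  weight T k x -> w \in supp sf x -> coef sf x w != 0 -> k = 2 * (wt w)%:Z.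
Proof.
move=> wx /supp_sorted sw cw.
have := coef_eigen (d := fun w => (wt w)%:R) (nprod_linearr T _) _ wx sw cw.
move=> /(_ (fun w' _ => Lmode0_mono sf Om_unit Om_skew w')) /eqP.
rewrite eq_sym; have two0 : 2%:R != 0 :> C by rewrite pnatr_eq0.
rewrite -(inj_eq (mulIf two0)) divfK // -natrM -[k%:~R == _]/(k%:~R == ((wt w * 2)%N%:Z)%:~R).
by rewrite eqr_int => /eqP->; rewrite mulnC PoszM.
Qed.

(** Reduces statements about all homogeneous vectors to the monomials. *)
Lemma weight_span k e x : weight T k x -> par W e x ->
  lspan (fun y => exists w, [/\ k = 2 * (wt w)%:Z, odd (size w) = e & y = mono w]) x.
Proof.
move=> wx px; rewrite [x](coefE sf) big_seq.
apply: subspace_sum => [|w ws]; first exact: lspan_subspace.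
have [->|cw] := eqVneq (coef sf x w) 0.
  by rewrite scale0r; case: (lspan_subspace (fun y => exists w, [/\ k = 2 * (wt w)%:Z, odd (size w) = e & y = mono w])).
apply: subspaceZ; first exact: lspan_subspace.
apply: mem_lspan; exists w; split=> //; first exact: weight_coef cw.
have := coef_eigen (d := fun w => (-1) ^+ size w) (dilation_linear (-1)) _ (parity_par px)
  (supp_sorted ws) cw.
move=> /(_ (fun w' _ => dilation_mono _ w')) /eqP.
by rewrite -signr_odd (inj_eq (@signr_inj C)) => /eqP.
Qed.

Lemma weight_neg k x : k < 0 -> weight T k x -> x = 0.
Proof.
move=> k0 wx; rewrite [x](coefE sf) big_seq big1 // => w ws.
have [->|/(weight_coef wx ws) kE] := eqVneq (coef sf x w) 0; first by rewrite scale0r.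
by move: k0; rewrite kE; lia.
Qed.

Lemma wt_bounds w : (size w <= wt w)%N /\ all (fun p => p.2 < wt w)%N w.
Proof.
elim: w => //= p w [IHs /allP IHa]; rewrite wt_cons; split; first by lia.
by rewrite addSn ltnS leq_addr /=; apply/allP=> q /IHa; lia.
Qed.

(** A monomial of weight h has at most h letters, and its mode indices are
    below h; there are finitely many such words. *)
Lemma weight_finite_dim k : finite_dim (weight T k).
Proof.
pose h := `|k|%N; pose I := {l : 'I_h.+1 & l.-tuple ('I_n * 'I_h)}.
pose f (p : 'I_n * 'I_h) : letter := (p.1, nat_of_ord p.2).
pose y (i : I) := mono (map f (val (tagged i))).
exists #|{: I}|, (fun j => y (enum_val j)) => x wx.
have [|c ->] := lspan_family (y := y) (x := x); last first.
  exists (fun j => c (enum_val j)).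
  rewrite -(big_enum_val (A := {: I}) (fun i => c i *: y i)).
  by apply: eq_bigl => i; rewrite inE.
rewrite [x](coefE sf) big_seq.
apply: subspace_sum => [|w ws]; first exact: lspan_subspace.
have [->|cw] := eqVneq (coef sf x w) 0.
  by rewrite scale0r; case: (lspan_subspace (fun z => exists i, z = y i)).
apply: subspaceZ; first exact: lspan_subspace.
have kE := weight_coef wx ws cw; have [szw allw] := wt_bounds w.
have hE : (wt w <= h)%N by rewrite /h kE abszM leq_pmull.
have lew : (size w < h.+1)%N by rewrite ltnS (leq_trans szw).
have allh : all (fun p => p.2 < h)%N w.
  by apply: sub_all allw => p /leq_trans; apply.
have [s sE] : exists s : seq ('I_n * 'I_h), w = map f s.
  elim: (w) allh => [|p w' IH] /=; first by exists [::].
  by move=> /andP[ph /IH[s ->]]; exists ((p.1, Ordinal ph) :: s); case: p ph.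
apply: mem_lspan.
have szs : size s == Ordinal lew by rewrite /= sE size_map.
by exists (Tagged (fun l : 'I_h.+1 => l.-tuple ('I_n * 'I_h)) (Tuple szs)); rewrite /y /= -sE.
Qed.

Lemma is_VOA_stress_tensor : is_VOA T.
Proof.
split.
- exact: par_stress_tensor sf.
- by exists (- n%:R); apply: virasoro_stress_tensor sf Om_unit Om_skew.
- exact: Lmode_deriv sf Om_unit Om_skew.
- move=> x; elim/(fock_ind sf): x => [|w]; first exact: lspan_subspace.
  by apply: mem_lspan; exists (2 * (wt w)%:Z); apply: weight_mono sf Om_unit Om_skew _.
- by exists 0 => k x; apply: weight_neg.
exact: weight_finite_dim.
Qed.

End WithStressTensor.

Local Notation F := (Sf_filt eta).

Lemma filt_subspaceE k : subspace (F k).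
Proof. exact: lspan_subspace. Qed.

Lemma filt_mono k w (i : nat) : (size w)%:Z = k - 2 * i%:Z -> F k (mono w).
Proof. by move=> E; apply: mem_lspan; exists i; apply: mem_lspan; exists w. Qed.

Lemma filt_ind (P : W -> Prop) k : subspace P ->
  (forall w (i : nat), (size w)%:Z = k - 2 * i%:Z -> P (mono w)) -> forall x, F k x -> P x.
Proof.
move=> subP Pm; apply: lspan_ind => // y [i ]; apply: lspan_ind => // _ [w [E ->]].
exact: Pm E.
Qed.

Lemma filt_mono_size w : F (size w) (mono w).
Proof. by apply: (filt_mono (i := 0)); rewrite mulr0 subr0. Qed.

Lemma filt_widen k (i : nat) x : F k x -> F (k + 2 * i%:Z) x.
Proof.
apply: filt_ind => [|w j E]; first exact: filt_subspaceE.
by apply: (filt_mono (i := (i + j)%N)); lia.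
Qed.

Lemma filt_creation k p x : F k x -> F (k + 1) (creation p x).
Proof.
apply: (filt_ind (P := fun x => F (k + 1) (creation p x))) => [|w i E].
  have [F0 lin] := filt_subspaceE (k + 1).
  by split=> [|c y z Fy Fz]; rewrite ?linear0 // linearP; apply: lin.
by apply: (filt_mono (w := p :: w) (i := i)); rewrite /=; lia.
Qed.

Lemma filt_annihilation k a m x : 0 <= m -> F k x -> F (k - 1) (nprod (eta a) m x).
Proof.
move=> m0; apply: (filt_ind (P := fun x => F (k - 1) (nprod (eta a) m x))) => [|w].
  have [F0 lin] := filt_subspaceE (k - 1).
  by split=> [|c y z Fy Fz]; rewrite ?linear0 // linearP; apply: lin.
elim: w k => [|p w IH] k i E; first by rewrite mode_vac //; case: (filt_subspaceE (k - 1)).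
rewrite /= (mode_creation sf); apply: subspaceB; first exact: filt_subspaceE.
  apply: subspaceZ; first exact: filt_subspaceE.
  by apply: (filt_mono (i := i)); move: E => /=; lia.
rewrite -[k - 1](subrK 1); apply: filt_creation; apply: (IH _ i).
by move: E => /=; lia.
Qed.

Lemma filt_mode k a m x : F k x -> F (k + 1) (nprod (eta a) m x).
Proof.
move=> Fx; have [m0|m0] := lerP 0 m; last by rewrite mode_neg //; apply: filt_creation.
have := filt_widen 1 (filt_annihilation a m0 Fx).
by rewrite (_ : k - 1 + 2 * 1%N%:Z = k + 1) //; ring.
Qed.

(** Induction on the length through the iterate formula. A creation mode raises
    the degree by 1/2 and an annihilation mode lowers it by 1/2. In a product of
    nonnegative index every term has an annihilation mode, at the head of the
    word or in its tail, which is where the degree drops by one. *)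
Lemma filt_nprod_mono w l m v : F l v ->
  F ((size w)%:Z + l) (nprod (mono w) m v) /\
  (0 <= m -> F ((size w)%:Z + l - 2) (nprod (mono w) m v)).
Proof.
elim: w l m v => [|p w IH] l m v Fv.
  rewrite /= add0r nprod_vacl; split=> [|m0]; first by case: ifP => // _; case: (filt_subspaceE l).
  by rewrite (_ : m == -1 = false); [case: (filt_subspaceE (l - 2)) | lia].
have [N /(_ N (leqnn N))] :=
  nprod_iterate (- p.2%:Z - 1) m v (sf_odd sf p.1) (par_mono w).
rewrite -[nprod (eta p.1) _ _]/(mono (p :: w)) => ->.
split=> [|m0]; apply: subspace_sum => [|j _]; try exact: filt_subspaceE.
  apply: subspaceZ; first exact: filt_subspaceE.
  apply: subspaceB; first exact: filt_subspaceE.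
    rewrite (_ : _ + l = (size w)%:Z + l + 1); last by rewrite /=; lia.
    by apply: filt_mode; apply: (IH _ _ _ Fv).1.
  apply: subspaceZ; first exact: filt_subspaceE.
  have := filt_widen 1 (IH _ (- p.2%:Z - 1 + m - j%:Z) _ (filt_annihilation p.1 (k := l) (m := j%:Z) isT Fv)).1.
  by rewrite (_ : _ + 2 * _ = (size (p :: w))%:Z + l) //=; lia.
apply: subspaceZ; first exact: filt_subspaceE.
apply: subspaceB; first exact: filt_subspaceE.
  rewrite (_ : _ + l - 2 = (size w)%:Z + l - 2 + 1); last by rewrite /=; lia.
  by apply: filt_mode; apply: (IH _ _ _ Fv).2; lia.
apply: subspaceZ; first exact: filt_subspaceE.
have := (IH _ (- p.2%:Z - 1 + m - j%:Z) _ (filt_annihilation p.1 (k := l) (m := j%:Z) isT Fv)).1.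
by rewrite (_ : _ + (l - 1) = (size (p :: w))%:Z + l - 2) //=; lia.
Qed.

Lemma filt_nprodE k l m x y : F k x -> F l y ->
  F (k + l) (nprod x m y) /\ (0 <= m -> F (k + l - 2) (nprod x m y)).
Proof.
move=> Fx Fy; split=> [|m0]; move: x Fx.
  apply: (filt_ind (P := fun x => F (k + l) (nprod x m y))) => [|w i E].
    split=> [|c z z' Fz Fz']; first by rewrite nprod0l; case: (filt_subspaceE (k + l)).
    by rewrite nprodDl nprodZl; apply: (filt_subspaceE (k + l)).2.
  have := filt_widen i (filt_nprod_mono w m Fy).1.
  by rewrite E (_ : _ + 2 * i%:Z = k + l) //; ring.
apply: (filt_ind (P := fun x => F (k + l - 2) (nprod x m y))) => [|w i E].
  split=> [|c z z' Fz Fz']; first by rewrite nprod0l; case: (filt_subspaceE (k + l - 2)).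
  by rewrite nprodDl nprodZl; apply: (filt_subspaceE (k + l - 2)).2.
have := filt_widen i ((filt_nprod_mono w m Fy).2 m0).
by rewrite E (_ : _ + 2 * i%:Z = k + l - 2) //; ring.
Qed.

Lemma half_integral_Sf_filt : half_integral_filtration (Sf_Z2 eta) F.
Proof.
split.
- exact: filt_subspaceE.
- by move=> k x Fx; have := filt_widen 1 Fx; rewrite mulr1.
- move=> k x Fx; apply/Sf_Z2E; move: x Fx; apply: filt_ind => [|w i E].
    exact: par_subspace.
  rewrite (_ : odd `|k| = odd (size w)); first exact: par_mono.
  by rewrite (_ : `|k|%N = (size w + i.*2)%N) ?oddD ?odd_double ?addbF //; lia.
- move=> e x /Sf_Z2E /par_parity_span; apply: (lspan_ind
    (P := fun x => exists k : int, odd `|k| = e /\ F k x)) => [|_ [w [<- ->]]]; last first.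
    by exists (size w); split=> //; apply: filt_mono_size.
  split=> [|c y z [k [Ek Fy]] [l [El Fz]]].
    by exists (e : nat); split; [case: (e) | case: (filt_subspaceE (e : nat))].
  (* Degrees of the same parity have a common upper bound that differs from
     both by integers. *)
  have [i [j ij]] : exists i j : nat, k + 2 * i%:Z = l + 2 * j%:Z.
    have [d dE] : exists d : int, k - l = 2 * d.
      exists ((k - l) %/ 2)%Z; rewrite mulrC divzK // dvdzE /= dvdn2.
      by move: Ek El; lia.
    by have [d0|d0] := lerP 0 d; [exists 0%N, `|d|%N | exists `|d|%N, 0%N]; lia.
  exists (k + 2 * i%:Z); split.
    by rewrite -Ek; lia.
  apply: (filt_subspaceE _).2; first exact: filt_widen.
  by rewrite ij; apply: filt_widen.
- exact: filt_mono_size [::].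
by move=> k l m x y Fx Fy; apply: (filt_nprodE m Fx Fy).1.
Qed.

Lemma good_Sf_filt : good_filtration F.
Proof. by move=> k l m x y m0 Fx Fy; apply: (filt_nprodE m Fx Fy).2. Qed.

End Gradings.

(** * The invariant form *)

Section InvariantForm.
Context {C : numClosedFieldType} {n : nat} {Om : 'M[C]_n}.
Context {W : vertexAlgebra C} {eta : 'I_n -> W}.
Hypothesis sf : symplectic_fermions Om eta.
Local Notation letter := ('I_n * nat)%type.
Local Notation mono := (monomial eta).
Local Notation creation := (creation (eta := eta)).
Local Notation parity := (parity sf).
Implicit Types (x y z u v : W) (p q : letter) (w : seq letter) (a b : 'I_n) (k l m : int).

Lemma vev_spec : exists f : W -> C, [/\ forall (a : C) x y, f (a *: x + y) = a * f x + f y,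
  f (vac W) = 1 & forall p x, f (creation p x) = 0].
Proof.
have [||f [flin fv fc]] :=
  fock_universal sf idfun (U := C^o) (A := fun _ _ => 0) 1; last by exists f.
  by move=> p a x y; rewrite scaler0 addr0.
by move=> p q x; rewrite oppr0.
Qed.

(** The coefficient of the vacuum. *)
Definition vev : W -> C := projT1 (cid vev_spec).

Lemma vev_linear (a : C) x y : vev (a *: x + y) = a * vev x + vev y.
Proof. by rewrite /vev; case: cid => f []. Qed.

Lemma vev_vac : vev (vac W) = 1.
Proof. by rewrite /vev; case: cid => f []. Qed.

Lemma vev_creation p x : vev (creation p x) = 0.
Proof. by rewrite /vev; case: cid => f []. Qed.

Lemma annihilation_anti a b k m x : 0 < k + m ->
  nprod (eta a) k (nprod (eta b) m x) = - nprod (eta b) m (nprod (eta a) k x).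
Proof.
move=> km; apply/eqP; rewrite -addr_eq0 (sf_ope sf); apply/eqP.
by rewrite (_ : _ == 0 = false) ?scale0r //; lia.
Qed.

Lemma parity_mode_parity a k v : parity (nprod (eta a) k (parity v)) = - nprod (eta a) k v.
Proof. by rewrite parity_mode parityK. Qed.

(** The last formula is the adjunction [form (creation p x) v =
    - form x (parity (nprod (eta p.1) p.2.+1 v))], with its right-hand side
    made odd in v. The universal property is applied to the space of all
    functions of v; on functions that are not odd the operators given by the
    plain adjunction would not anticommute. *)
Lemma form_spec : exists f : W -> W -> C,
  [/\ forall (a : C) x y v, f (a *: x + y) v = a * f x v + f y v,
      forall v, f (vac W) v = vev v
    & forall p x v, let v' := parity (nprod (eta p.1) p.2.+1 v) in
        f (creation p x) v = 2%:R^-1 * (f x (- v') - f x v')].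
Proof.
have [||f [flin fv fc]] := fock_universal sf idfun (U := (W -> C^o))
  (A := fun p (phi : W -> C^o) v => let v' := parity (nprod (eta p.1) p.2.+1 v) in
     2%:R^-1 * (phi (- v') - phi v')) vev.
- move=> p a f g; apply/funext => v; rewrite !fctE /=.
  by rewrite /GRing.scale /=; ring.
- move=> p q f; apply/funext => v; rewrite !fctE /=.
  rewrite ![nprod _ _ (- _)]linearN /= ![parity (- _)]linearN /= !parity_mode_parity !opprK.
  by rewrite (@annihilation_anti p.1 q.1 p.2.+1 q.2.+1) ?opprK //; ring.
by exists f; split=> [a x y v|v|p x v]; [rewrite flin | rewrite fv | rewrite fc].
Qed.

Definition form : W -> W -> C := projT1 (cid form_spec).

Lemma form_linearl (a : C) x y v : form (a *: x + y) v = a * form x v + form y v.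
Proof. by rewrite /form; case: cid => f []. Qed.

Lemma form_vac v : form (vac W) v = vev v.
Proof. by rewrite /form; case: cid => f []. Qed.

Lemma form_creation_odd p x v : let v' := parity (nprod (eta p.1) p.2.+1 v) in
  form (creation p x) v = 2%:R^-1 * (form x (- v') - form x v').
Proof. by rewrite /form; case: cid => f []. Qed.

Lemma form0l v : form 0 v = 0.
Proof. by have := form_linearl (-1) 0 0 v; rewrite scaler0 addr0 mulN1r addNr. Qed.

Lemma form_linearr x (a : C) u v : form x (a *: u + v) = a * form x u + form x v.
Proof.
elim/(fock_rect sf): x => [||p x IH] in a u v *.
- split=> [|c y z Hy Hz] a u v; first by rewrite !form0l mulr0 addr0.
  by rewrite !form_linearl Hy Hz; ring.
- by rewrite !form_vac vev_linear.
by rewrite !form_creation_odd /= linearP /= linearP /= opprD -!scalerN !IH; ring.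
Qed.

Lemma form_creation p x v :
  form (creation p x) v = - form x (parity (nprod (eta p.1) p.2.+1 v)).
Proof.
have two0 : 2%:R != 0 :> C by rewrite pnatr_eq0.
have formN u : form x (- u) = - form x u.
  have := form_linearr x (-1) u 0; have := form_linearr x (-1) 0 0.
  by rewrite scaler0 addr0 mulN1r addNr scaleN1r addr0 => ->; rewrite addr0 mulN1r.
by rewrite form_creation_odd /= formN; field.
Qed.

HB.instance Definition _ := bilinear_isBilinear.Build C W W C *%R *%R form
  (conj (fun u' (a : C) x y => form_linearl a x y u') (fun x (a : C) u v => form_linearr x a u v)).

Lemma vev_parity v : vev (parity v) = vev v.
Proof.
elim/(fock_rect sf): v => [||p v _].
- split=> [|c y z Hy Hz]; first by rewrite linear0.
  by rewrite linearP !vev_linear Hy Hz.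
- by rewrite parity_vac.
by rewrite parity_creation -form_vac linearNr /= form_vac !vev_creation oppr0.
Qed.

Lemma form_parity u v : form (parity u) (parity v) = form u v.
Proof.
elim/(fock_rect sf): u => [||p u IH] in v *.
- split=> [|c y z Hy Hz] v; first by rewrite linear0 !form0l.
  by rewrite linearP /= !form_linearl Hy Hz.
- by rewrite parity_vac !form_vac vev_parity.
rewrite parity_creation linearNl /= !form_creation opprK IH.
by rewrite !parity_mode linearNr /= opprK.
Qed.

Section WithSkewPairing.
Hypothesis Om_unit : Om \in unitmx.
Hypothesis Om_skew : forall a b, Om b a = - Om a b.
Local Notation T := (stress_tensor Om eta).

(** The invariance for the generating fields, with [parity u] for the sign
    (-1)^|u|. It holds by construction for the creation modes. The two
    contractions that arise when an annihilation mode is moved through a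
    creation mode on either side cancel because the inverse of [Om] is skew. *)
Lemma form_mode a m u v : form (nprod (eta a) m u) v = - form (parity u) (nprod (eta a) (- m) v).
Proof.
have negc p x y : form (creation p x) y = - form (parity x) (nprod (eta p.1) p.2.+1 y).
  by rewrite form_creation -[in RHS]form_parity parityK.
have neg b k x y : k < 0 -> form (nprod (eta b) k x) y = - form (parity x) (nprod (eta b) (- k) y).
  by move=> k0; rewrite mode_neg // negc /=; congr (- form _ (nprod _ _ _)); lia.
have [m0|m0|->] := ltrgtP m 0; first exact: neg; last first.
  by rewrite oppr0 !(mode_zero sf) form0l linear0r oppr0.
elim/(fock_rect sf): u => [||p u IH] in v *.
- split=> [|c y z Hy Hz] v; first by rewrite !linear0 !form0l oppr0.
  by rewrite !linearP /= !form_linearl Hy Hz; ring.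
- rewrite mode_vac ?ltW // form0l parity_vac form_vac.
  by rewrite mode_neg ?oppr_lt0 // vev_creation oppr0.
rewrite (mode_creation sf) linearBl linearZl_LR /= negc opprK -[form (parity _) _]form_parity parityK.
rewrite IH -[nprod _ _ (parity _)]opprK -parity_mode linearNr /= opprK form_parity.
rewrite parity_creation linearNl /= opprK negc parityK.
rewrite (canRL (addrK _) (sf_ope sf p.1 a p.2.+1 (- m) v)) linearBr linearZr_LR /= opprB addrC.
congr (_ + _); rewrite -mulNr (_ : (_ + - m == 0) = (m == p.2.+1)); last by lia.
by case: eqP => [->|_]; rewrite ?oppr0 // (iOm_skew Om_unit Om_skew p.1 a) mulrN.
Qed.

Lemma Lmode_comm m k x : m + k != 0 ->
  Lmode T m (Lmode T k x) = Lmode T k (Lmode T m x) + (m - k)%:~R *: Lmode T (m + k) x.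
Proof.
move=> mk; have := virasoro_stress_tensor sf Om_unit Om_skew m k x.
by rewrite (negPf mk) scale0r addr0 => /(canRL (subrK _)) ->; rewrite addrC.
Qed.

Lemma weight_Lmode m k x : m != 0 -> weight T k x -> weight T (k - 2 * m) (Lmode T m x).
Proof.
move=> m0 wx; rewrite /weight Lmode_comm ?add0r // wx linearZ /= -scalerDl; congr (_ *: _).
rewrite rmorphB rmorphM /= mulrBl mulrAC divff ?pnatr_eq0 // mul1r.
by rewrite rmorphN.
Qed.

Lemma par_Lmode e m x : par W e x -> par W e (Lmode T m x).
Proof. by move=> px; rewrite -[e]addFb; apply: par_nprod => //; apply: par_stress_tensor sf. Qed.

Local Notation L1 := (Lmode T 1).

Lemma iter_L1_linear j : linear (iter j L1).
Proof.
move=> a x y; elim: j => //= j ->.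
by rewrite linearP.
Qed.

HB.instance Definition _ j := GRing.isLinear.Build C W W _ (iter j L1) (iter_L1_linear j).

Lemma weight_iter_L1 k j x : weight T k x -> weight T (k - 2 * j%:Z) (iter j L1 x).
Proof.
move=> wx; elim: j => [|j IH]; first by rewrite mulr0 subr0.
by have := weight_Lmode (m := 1) isT IH; rewrite (_ : _ - 2 * 1 = k - 2 * j.+1%:Z) //; lia.
Qed.

Lemma iter_L1_eq0 (h j : nat) x : weight T (2 * h%:Z) x -> (h < j)%N -> iter j L1 x = 0.
Proof.
move=> wx hj; apply: (weight_neg sf Om_unit Om_skew) (weight_iter_L1 j wx); lia.
Qed.

Lemma par_iter_L1 e j x : par W e x -> par W e (iter j L1 x).
Proof. by move=> px; elim: j => //= j; apply: par_Lmode. Qed.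

(** The commutator of L_1 and eta^a_(-1) is the zero mode of eta^a, which
    vanishes. *)
Lemma iter_L1_creation0 a j x :
  iter j L1 (creation (a, 0%N) x) = creation (a, 0%N) (iter j L1 x).
Proof.
elim: j => //= j ->; rewrite (Lmode_creation sf Om_unit Om_skew) /=.
by rewrite subr0 subrr (mode_zero sf) scaler0 addr0.
Qed.

(** From the relation L_1 L_(-1) = L_(-1) L_1 + 2 L_0; the coefficients
    (j + 1) (2 h - j) are those of the Verma module of weight h over sl_2. *)
Lemma iter_L1_deriv (h j : nat) x : weight T (2 * h%:Z) x ->
  iter j.+1 L1 (Defs.deriv x) = Defs.deriv (iter j.+1 L1 x)
    + (j.+1%:Z * (2 * h%:Z - j%:Z))%:~R *: iter j L1 x.
Proof.
move=> wx; have commL y : L1 (Defs.deriv y) = Defs.deriv (L1 y) + 2%:R *: Lmode T 0 y.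
  rewrite -!(Lmode_deriv sf Om_unit Om_skew).
  have := virasoro_stress_tensor sf Om_unit Om_skew 1 (-1) y.
  rewrite subrr eqxx mulr0z !mul0r scale0r addr0 => /(canRL (subrK _)) ->.
  by rewrite addrC.
elim: j => [|j IH].
  rewrite /= commL; congr (_ + _); rewrite wx scalerA; congr (_ *: _).
  by rewrite mul1r subr0 rmorphM /= mulrCA divff ?mulr1 ?pnatr_eq0.
rewrite [LHS]/= -/(iter j.+1 L1 (Defs.deriv x)) IH linearD linearZ /= commL -addrA; congr (_ + _).
have := weight_iter_L1 j.+1 wx; rewrite /weight /= => ->.
rewrite scalerA -scalerDl; congr (_ *: _).
rewrite mulrC divfK ?pnatr_eq0 // -rmorphD; congr (_%:~R); lia.
Qed.

(** The modes of Y(e^(zL_1) (-z^(-2))^(L_0) x, z^(-1)) for x of weight k/2,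
    with the exponential series cut at M. *)
Definition dag (k : int) x m (M : nat) v : W :=
  \sum_(j < M) ('i ^ k / j`!%:R) *: nprod (iter j L1 x) (k - j%:Z - m - 2) v.

Lemma dag_linearl k m v M : linear (fun x => dag k x m M v).
Proof.
move=> a x y; rewrite /dag scaler_sumr -big_split; apply: eq_bigr => j _ /=.
by rewrite linearP nprodDl nprodZl scalerDr !scalerA mulrC.
Qed.

Lemma dag_linearr k x m M : linear (dag k x m M).
Proof.
move=> a u v; rewrite /dag scaler_sumr -big_split; apply: eq_bigr => j _ /=.
by rewrite linearP scalerDr !scalerA mulrC.
Qed.

HB.instance Definition _ k x m M := GRing.isLinear.Build C W W _ (dag k x m M) (dag_linearr k x m M).

(** For homogeneous x of weight h: the invariance of [form] with respect to the
    field of x. The powers of L_1 vanish on x beyond h, whence the bound on M;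
    the iterated parity is the sign (-1)^(|x||u|). *)
Definition invariant_vector (h : nat) (e : bool) x : Prop :=
  [/\ weight T (2 * h%:Z) x, par W e x
    & forall m u v M, (h < M)%N ->
        form (nprod x m u) v = form (iter e parity u) (dag (2 * h%:Z) x m M v)].

Lemma weight_subspace k : subspace (weight T k).
Proof.
rewrite /weight; split=> [|a x y Hx Hy]; first by rewrite linear0 scaler0.
by rewrite linearP /= Hx Hy scalerDr !scalerA mulrC.
Qed.

Lemma invariant_vector_subspace h e : subspace (invariant_vector h e).
Proof.
split=> [|a x y [wx px Hx] [wy py Hy]]; split.
- by case: (weight_subspace (2 * h%:Z)).
- by case: (par_subspace (W := W) e).
- move=> m u v M _; rewrite nprod0l form0l /dag big1 ?linear0r // => j _.
  by rewrite linear0 nprod0l scaler0.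
- exact: (weight_subspace _).2.
- exact: (par_subspace e).2.
move=> m u v M hM; rewrite nprodDl nprodZl form_linearl (Hx _ _ _ M) // (Hy _ _ _ M) //.
by rewrite dag_linearl form_linearr.
Qed.

Lemma invariant_vector_vac : invariant_vector 0 false (vac W).
Proof.
have w0 : weight T (2 * 0%:Z) (vac W).
  by have := weight_mono sf Om_unit Om_skew [::]; rewrite /wt big_nil.
split=> //; first exact: par_vac.
move=> m u v [//|M] _; rewrite /dag big_ord_recl big1 => [|j _]; last first.
  by rewrite (iter_L1_eq0 w0) ?nprod0l ?scaler0.
rewrite /= mulr0 expr0z divr1 scale1r addr0 !nprod_vacl.
rewrite (_ : (_ == -1) = (m == -1)); last by lia.
by case: eqP; rewrite ?form0l ?linear0r.
Qed.

(** With (d x)_m = - m x_(m-1), the modes of the adjoint field have to satisfy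
    the same relation. The powers of L_1 on d x are those of [iter_L1_deriv];
    the terms with d and those without are both multiples of the terms A j, and
    their coefficients add up to m / j!. *)
Lemma dag_deriv (h : nat) e x m v (M : nat) : weight T (2 * h%:Z) x -> par W e x -> (h < M)%N ->
  dag (2 * h.+1%:Z) (Defs.deriv x) m M.+1 v = - m%:~R *: dag (2 * h%:Z) x (m - 1) M v.
Proof.
move=> wx px hM.
have iE : 'i ^ (2 * h.+1%:Z) = - 'i ^ (2 * h%:Z) :> C.
  by rewrite (_ : 2 * h.+1%:Z = 2 * h%:Z + 2%N%:Z) ?expfzDr ?neq0Ci //; [rewrite -[_ ^ 2%N]/('i ^+ 2) sqrCi mulrN1 | lia].
pose A j := nprod (iter j L1 x) (2 * h%:Z - j%:Z - m - 1) v.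
have AM : A M = 0 by rewrite /A (iter_L1_eq0 wx) ?nprod0l.
pose D j := nprod (Defs.deriv (iter j L1 x)) (2 * h%:Z - j%:Z - m) v.
have DE j : D j = (j%:Z + m - 2 * h%:Z)%:~R *: A j.
  rewrite /D (deriv_nprodl sf Om_unit Om_skew _ _ (par_iter_L1 j px)) -rmorphN /=.
  by congr (_%:~R *: _); ring.
rewrite /dag iE big_ord_recl /= scaler_sumr.
transitivity (\sum_(j < M.+1) (- 'i ^ (2 * h%:Z) / j`!%:R) *: D j
   + \sum_(j < M) (- 'i ^ (2 * h%:Z) / j`!%:R * (2 * h%:Z - j%:Z)%:~R) *: A j).
  rewrite [X in _ = X + _]big_ord_recl -[RHS]addrA /=; congr (_ + _).
    by rewrite /D /=; congr (_ *: nprod _ _ _); lia.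
  rewrite -big_split /=; apply: eq_bigr => j _; rewrite /bump /= add1n add0n.
  rewrite -[L1 _]/(iter j.+1 L1 (Defs.deriv x)) (iter_L1_deriv _ wx) nprodDl nprodZl scalerDr.
  congr (_ + _); first by rewrite /D /=; congr (_ *: nprod _ _ _); lia.
  rewrite scalerA /A; congr (_ *: nprod _ _ _); last by lia.
  have f0 : j`!%:R != 0 :> C by rewrite pnatr_eq0 -lt0n fact_gt0.
  have s0 : j.+1%:R != 0 :> C by rewrite pnatr_eq0.
  rewrite factS natrM rmorphM /= -[j.+1%:~R]/(j.+1%:R).
  by move: (j.+1%:R) s0 (j`!%:R) f0 => s s0 f f0; field; rewrite s0 f0.
rewrite big_ord_recr /= DE AM !scaler0 addr0 -big_split; apply: eq_bigr => j _ /=.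
rewrite DE !scalerA -scalerDl /A; congr (_ *: nprod _ _ _); last by lia.
by rewrite !(rmorphB, rmorphD, rmorphM) /=; ring.
Qed.

Lemma invariant_vector_deriv h e x :
  invariant_vector h e x -> invariant_vector h.+1 e (Defs.deriv x).
Proof.
move=> [wx px Hx]; split.
- rewrite -(Lmode_deriv sf Om_unit Om_skew).
  have := weight_Lmode (m := -1) isT wx.
  by rewrite (_ : _ - 2 * -1 = 2 * h.+1%:Z) //; lia.
- exact: par_deriv.
move=> m u v [//|M] hM; rewrite (dag_deriv _ _ wx px) // (deriv_nprodl sf Om_unit Om_skew _ _ px).
by rewrite linearZl_LR linearZr_LR /= (Hx _ _ _ M).
Qed.

Lemma eventually_all (P : nat -> nat -> Prop) (M : nat) :
  (forall j, eventually (P j)) -> eventually (fun K => forall j, (j < M)%N -> P j K).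
Proof.
move=> evP; elim: M => [|M [N HN]]; first by exists 0%N.
have [N' HN'] := evP M; exists (maxn N N') => K; rewrite geq_max => /andP[NK NK'] j.
by rewrite ltnS leq_eqVlt => /orP[/eqP->|]; [exact: HN' | exact: HN].
Qed.
End WithSkewPairing.

End InvariantForm.

Section Invariance.
Context {C : numClosedFieldType} {n : nat} {Om : 'M[C]_n}.
Context {W : vertexAlgebra C} {eta : 'I_n -> W}.
Hypothesis sf : symplectic_fermions Om eta.
Hypothesis Om_unit : Om \in unitmx.
Hypothesis Om_skew : forall a b, Om b a = - Om a b.
Local Notation letter := ('I_n * nat)%type.
Local Notation mono := (monomial eta).
Local Notation creation := (creation (eta := eta)).
Local Notation parity := (parity sf).
Local Notation form := (form sf).
Local Notation dag := (dag (Om := Om) (eta := eta)).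
Local Notation T := (stress_tensor Om eta).
Local Notation L1 := (Lmode T 1).
Local Notation invariant_vector := (invariant_vector sf).
Implicit Types (x y z u v : W) (p q : letter) (w : seq letter) (a b : 'I_n) (k l m : int).

Lemma parity_nprod e x m u : par W e x ->
  parity (nprod x m u) = (-1) ^+ e *: nprod x m (parity u).
Proof.
move=> px; have [u0 [u1 [/(parity_span_par sf) p0 /(parity_span_par sf) p1 ->]]] :=
  parity_span_decomposition sf u.
rewrite !linearD /= (parity_par sf (par_nprod m px p0)) (parity_par sf (par_nprod m px p1)).
rewrite (parity_par sf p0) (parity_par sf p1) !linearZ /= ?scalerDr !scalerA.
by rewrite addbF addbT; case: (e); rewrite ?expr1 ?expr0 ?mulrNN ?mul1r ?mulr1.
Qed.

Lemma iter_parity_mode (e : nat) a k u :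
  iter e parity (nprod (eta a) k u) = (-1) ^+ e *: nprod (eta a) k (iter e parity u).
Proof.
elim: e => [|e /= ->]; first by rewrite scale1r.
by rewrite linearZ /= parity_mode exprS scalerN mulN1r scaleNr.
Qed.

(** Both fields are expanded by [nprod_normal_order]. Taking adjoints exchanges
    the two families of terms, up to a shift of the index by one; the term that
    this leaves over contains the zero mode of [eta a], which vanishes. *)
Lemma invariant_vector_creation0 h e a x :
  invariant_vector h e x -> invariant_vector h.+1 (~~ e) (creation (a, 0%N) x).
Proof.
move=> [wx px Hx]; have wy : weight T (2 * h.+1%:Z) (creation (a, 0%N) x).
  rewrite /weight (Lmode_creation sf Om_unit Om_skew) wx linearZ /=.
  rewrite -[nprod _ _ x]/(creation (a, 0%N) x).
  rewrite -scalerDl; congr (_ *: _).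
  rewrite (_ : 2 * h.+1%:Z = 2 * h%:Z + 2); last by lia.
  rewrite rmorphD /= [RHS]mulrDl; congr (_ + _); by apply/esym/divff; rewrite pnatr_eq0.
have yE z : creation (a, 0%N) z = nprod (eta a) (-1) z by rewrite /creation oppr0 add0r.
split=> // [|m u v [//|M] hM].
  by rewrite -addTb; apply: par_nprod => //; apply: sf_odd sf _.
have {}hM : (h < M.+1)%N by exact: ltnW.
move: M.+1 hM => {}M hM.
pose A j := iter j L1 x.
have [N HN] := nprod_normal_order m u (sf_odd sf a) px.
have evA j : eventually (fun K =>
    nprod (nprod (eta a) (-1) (A j)) (2 * h.+1%:Z - j%:Z - m - 2) v =
      \sum_(i < K) nprod (eta a) (- 1 - i%:Z) (nprod (A j) (2 * h.+1%:Z - j%:Z - m - 2 + i%:Z) v)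
      + (-1) ^+ e *: \sum_(i < K.+1)
          nprod (A j) (2 * h.+1%:Z - j%:Z - m - 2 - 1 - i%:Z) (nprod (eta a) i%:Z v)).
  have [N' HN'] := nprod_normal_order (2 * h.+1%:Z - j%:Z - m - 2) v (sf_odd sf a)
    (par_iter_L1 sf j px).
  by exists N' => K leK; apply: HN' => //; apply: leqW.
have [N' HN'] := eventually_all M evA.
(* K terms in the first family and K + 1 in the second one, on both sides. *)
pose K := maxn N N'.
have [leN leN'] : (N <= K)%N /\ (N' <= K)%N by lia.
have {HN'} HA := HN' K leN'.
pose u' := iter e.+1 parity u.
have -> : iter (~~ e) parity u = u' by rewrite /u'; case: (e) => //=; rewrite parityK.
have iE : 'i ^ (2 * h.+1%:Z) = - 'i ^ (2 * h%:Z) :> C.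
  by rewrite (_ : 2 * h.+1%:Z = 2 * h%:Z + 2%N%:Z) ?expfzDr ?neq0Ci //;
    [rewrite -[_ ^ 2%N]/('i ^+ 2) sqrCi mulrN1 | lia].
have term1 (i : nat) : form (nprod (eta a) (- 1 - i%:Z) (nprod x (m + i%:Z) u)) v =
    - ((-1) ^+ e * form u' (dag (2 * h%:Z) x (m + i%:Z) M (nprod (eta a) i.+1 v))).
  rewrite (form_mode sf Om_unit Om_skew) (parity_nprod _ _ px) linearZl_LR /= (Hx _ _ _ M) //.
  by rewrite -iterSr; congr (- (_ * form _ (dag _ _ _ _ (nprod _ _ _)))); lia.
have term2 (i : nat) : (-1) ^+ e * form (nprod x (m - 1 - i.+1%:Z) (nprod (eta a) i.+1 u)) v =
    - form u' (nprod (eta a) (- 1 - i%:Z) (dag (2 * h%:Z) x (m - 2 - i%:Z) M v)).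
  rewrite (Hx _ _ _ M) // iter_parity_mode linearZl_LR /= mulrA -expr2 sqrr_sign mul1r.
  rewrite (form_mode sf Om_unit Om_skew) -iterS.
  by congr (- form _ (nprod _ _ (dag _ _ _ _ _))); lia.
have -> : dag (2 * h.+1%:Z) (creation (a, 0%N) x) m M v =
    - \sum_(i < K) nprod (eta a) (- 1 - i%:Z) (dag (2 * h%:Z) x (m - 2 - i%:Z) M v)
    - (-1) ^+ e *: \sum_(i < K) dag (2 * h%:Z) x (m + i%:Z) M (nprod (eta a) i.+1 v).
  rewrite /dag iE.
  under [X in _ = - X - _]eq_bigr do rewrite linear_sum.
  rewrite [X in _ = - X - _]exchange_big [X in _ = _ - _ *: X]exchange_big /=.
  rewrite scaler_sumr -!sumrN -big_split; apply: eq_bigr => j _ /=.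
  rewrite (iter_L1_creation0 sf Om_unit Om_skew) yE HA // mulNr scaleNr scalerDr opprD.
  congr (- _ - _).
    rewrite scaler_sumr; apply: eq_bigr => i _; rewrite linearZ /=.
    by congr (_ *: nprod _ _ (nprod _ _ _)); lia.
  rewrite big_ord_recl (mode_zero sf) linear0 add0r -scaler_sumr scalerA mulrC -scalerA.
  congr (_ *: (_ *: _)); apply: eq_bigr => i _.
  by rewrite lift0; congr (nprod _ _ _); lia.
rewrite {1}yE (HN K K.+1) ?leqW // andTb {HN}.
rewrite big_ord_recl (mode_zero sf) linear0 add0r linearDl linearZl_LR /= !linear_sumlz /=.
rewrite linearBr linearNr /= linearZr_LR /= !linear_sumr /= addrC mulr_sumr.
congr (_ + _); first by rewrite -sumrN; apply: eq_bigr => i _; rewrite -term2 /bump add1n.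
by rewrite mulr_sumr -sumrN; apply: eq_bigr => i _; rewrite -term1.
Qed.

(** The derivation d gives (j + 1) eta^b_(-j-2) = [d, eta^b_(-j-1)], so that all
    creation modes are reached from eta^b_(-1) and d. *)
Lemma invariant_vector_creation (b : 'I_n) (j : nat) h e x :
  invariant_vector h e x -> invariant_vector (h + j.+1) (~~ e) (creation (b, j) x).
Proof.
elim: j h x => [|j IH] h x Ix; first by rewrite addn1; apply: invariant_vector_creation0.
have sub := invariant_vector_subspace sf (h + j.+2) (~~ e).
have -> : creation (b, j.+1) x =
    j.+1%:R^-1 *: (Defs.deriv (creation (b, j) x) - creation (b, j) (Defs.deriv x)).
  rewrite /creation deriv_nprod /= (_ : - j%:Z - 1 = - j.+1%:Z); last by lia.
  rewrite mulrNz opprK scalerA mulVf ?scale1r ?pnatr_eq0 //.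
apply: (subspaceZ _ sub); apply: (subspaceB sub).
  by rewrite addnS; apply: invariant_vector_deriv => //; apply: IH.
by rewrite addnS -addSn; apply: IH; apply: invariant_vector_deriv.
Qed.

Lemma invariant_vector_mono w : invariant_vector (wt w) (odd (size w)) (mono w).
Proof.
elim: w => [|[b j] w IH]; first by rewrite /wt big_nil; apply: invariant_vector_vac.
by rewrite wt_cons addnC; apply: invariant_vector_creation.
Qed.

(** By linearity from the monomials, which are reached from the vacuum by
    [invariant_vector_creation]. *)
Lemma invariance k e x m u v (M : nat) : weight T k x -> par W e x -> (`|k| < M)%N ->
  form (nprod x m u) v = form (iter e parity u) (dag k x m M v).
Proof.
move=> wx px kM.
apply: (lspan_ind (P := fun x => form (nprod x m u) v = form (iter e parity u) (dag k x m M v)))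
  (weight_span sf Om_unit Om_skew wx px) => [|_ [w [kE <- ->]]].
  split=> [|c y z Hy Hz].
    have -> : dag k 0 m M v = 0 by apply: (linear_fun0 (dag_linearl k m v M)).
    by rewrite nprod0l form0l linear0r.
  by rewrite nprodDl nprodZl (dag_linearl k m v M) form_linearl form_linearr Hy Hz.
have [_ _ inv] := invariant_vector_mono w.
by rewrite kE; apply: inv; move: kM; rewrite kE; lia.
Qed.

Lemma invariant_form_form : invariant_form T form.
Proof.
have sign (q : bool) u (e : nat) : par W q u -> iter e parity u = (-1) ^+ (q * e) *: u.
  move=> qu; elim: e => [|e /= ->]; first by rewrite muln0 scale1r.
  by rewrite linearZ /= (parity_par sf qu) scalerA -exprD mulnS addnC.
split=> [e q k m x u v wx px qu|m _ u v].
  exists `|k|.+1 => M kM.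
  rewrite (invariance _ _ _ wx px kM) (sign q) // linearZl_LR /= mulnb andbC; congr (_ * _).
  by rewrite /dag linear_sumr; apply: eq_bigr => j _; rewrite linearZr_LR.
have wT : weight T 4 T.
  rewrite /weight (Lmode0_stress_tensor sf Om_unit Om_skew); congr (_ *: _).
  by apply: (canRL (mulfK _)); rewrite ?pnatr_eq0 // -natrM.
rewrite /Lmode (invariance _ _ _ wT (par_stress_tensor sf) (ltnSn _)) /=.
congr (form u _); rewrite /dag big_ord_recl big1 => [|j _]; last first.
  have L0 i : iter i.+1 L1 T = 0.
    elim: i => [|i IHi]; last by rewrite iterS IHi linear0.
    exact: Lmode1_stress_tensor sf Om_unit Om_skew.
  by rewrite L0 nprod0l scaler0.
rewrite addr0 /= divr1 (_ : 'i ^ 4 = 1 :> C) ?scale1r; first by congr (nprod _ _ _); lia.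
by rewrite -[_ ^ 4]/('i ^+ (2 * 2)) exprM sqrCi sqrrN expr1n.
Qed.

Lemma form_vac_vac : form (vac W) (vac W) = 1.
Proof. by rewrite form_vac vev_vac. Qed.

Lemma weight_eta a : weight T 2 (eta a).
Proof.
rewrite etaE; have := weight_mono sf Om_unit Om_skew [:: (a, 0%N)].
by rewrite wt_cons /wt big_nil.
Qed.

Lemma iter_L1_eta a j : iter j.+1 L1 (eta a) = 0.
Proof.
rewrite etaE (iter_L1_creation0 sf Om_unit Om_skew) iterSr Lmode_vac //.
by rewrite !linear0.
Qed.

Lemma invariant_form_mode (B : {biscalar W}) a m (e : bool) u v : invariant_form T B ->
  par W e u -> B (nprod (eta a) m u) v = - ((-1) ^+ e * B u (nprod (eta a) (- m) v)).
Proof.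
move=> [invB _] pu; have [N] := invB true e 2 m (eta a) u v (weight_eta a) (sf_odd sf a) pu.
move=> /(_ N.+1 (leqnSn N)) ->; rewrite big_ord_recl big1 => [|j _]; last first.
  by rewrite lift0 iter_L1_eta nprod0l linear0r mulr0.
rewrite addr0 /= divr1 -[_ ^ 2]/('i ^+ 2) sqrCi mulN1r mulrN; congr (- (_ * B _ (nprod _ _ _))).
lia.
Qed.

(** The invariance for the fields [eta a] moves all modes to the right, where
    only the vacuum component is left. *)
Lemma invariant_form_unique (B : {biscalar W}) :
  invariant_form T B -> B (vac W) (vac W) = 1 -> B =2 form.
Proof.
move=> invB B1.
have Bvac v : B (vac W) v = form (vac W) v.
  elim/(fock_rect sf): v => [||p v _].
  - split=> [|c y z Hy Hz]; first by rewrite !linear0r.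
    by rewrite !linearPr Hy Hz.
  - by rewrite B1 form_vac_vac.
  rewrite form_vac vev_creation.
  have := invariant_form_mode p.1 p.2.+1 v invB (par_vac W).
  rewrite mode_vac // linear0l expr0 mul1r => /eqP; rewrite eq_sym oppr_eq0 => /eqP <-.
  by congr (B _ (nprod _ _ _)); lia.
have invf := invariant_form_form.
move=> x; elim/(fock_ind sf): x => [|w v].
  split=> [v|c y z Hy Hz v]; first by rewrite !linear0l.
  by rewrite !linearPl Hy Hz.
elim: w v => [|p w IH] v; first exact: Bvac.
rewrite [monomial _ _]/= (invariant_form_mode _ _ _ invB (par_mono sf w)).
by rewrite (invariant_form_mode _ _ _ invf (par_mono sf w)) IH.
Qed.

End Invariance.

(** * The conjugation *)

Section Conjugation.
Context {C : numClosedFieldType} {n : nat} {Om : 'M[C]_n}.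
Context {W : vertexAlgebra C} {eta : 'I_n -> W}.
Hypothesis sf : symplectic_fermions Om eta.
Hypothesis Om_unitary : Om \is unitarymx.
Hypothesis Om_skew : forall a b, Om b a = - Om a b.
Local Notation letter := ('I_n * nat)%type.
Local Notation mono := (monomial eta).
Local Notation creation := (creation (eta := eta)).
Local Notation parity := (parity sf).
Local Notation dilation := (dilation sf).
Local Notation T := (stress_tensor Om eta).
Local Notation F := (Sf_filt eta).
Implicit Types (x y z u v : W) (p q : letter) (w : seq letter) (a b c d : 'I_n) (k l m : int).

Let Om_unit : Om \in unitmx := unitarymx_unit Om_unitary.

Lemma conj_invmx a b : (invmx Om a b)^* = Om b a.
Proof. by rewrite invmx_unitary // !mxE conjCK. Qed.

Lemma conj_Om a b : (Om a b)^* = invmx Om b a.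
Proof. by rewrite -(conjCK (invmx Om b a)) conj_invmx. Qed.

Definition conj_eta b : W := - 'i *: \sum_a Om a b *: eta a.

Lemma conj_eta_nprod b k x :
  nprod (conj_eta b) k x = \sum_a (- 'i * Om a b) *: nprod (eta a) k x.
Proof.
rewrite /conj_eta scaler_sumr nprod_suml; apply: eq_bigr => a _.
by rewrite scalerA nprodZl.
Qed.

Lemma par_conj_eta b : par W true (conj_eta b).
Proof.
apply: (subspaceZ _ (par_subspace true)); apply: (subspace_sum _ (par_subspace true)) => a _.
by apply: (subspaceZ _ (par_subspace true)); apply: sf_odd sf _.
Qed.

Lemma parity_conj_eta b k x :
  parity (nprod (conj_eta b) k x) = - nprod (conj_eta b) k (parity x).
Proof. by rewrite (parity_nprod sf _ _ (par_conj_eta b)) expr1 scaleN1r. Qed.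

(** The images of the generators satisfy the relations of the generators with
    [Om b c] in place of the inverse matrix. By unitarity and skewness
    [Om b c] is minus the conjugate of that inverse entry; the minus sign is the
    one in rho (x_n y) = - rho(x)_n rho(y) for odd x and y. *)
Lemma conj_eta_ope b c k m x :
  nprod (conj_eta b) k (nprod (conj_eta c) m x) + nprod (conj_eta c) m (nprod (conj_eta b) k x)
  = (if k + m == 0 then k%:~R * Om b c else 0) *: x.
Proof.
have expand b' c' k' m' : nprod (conj_eta b') k' (nprod (conj_eta c') m' x) =
    - \sum_a \sum_d (Om a b' * Om d c') *: nprod (eta a) k' (nprod (eta d) m' x).
  rewrite !conj_eta_nprod -sumrN; apply: eq_bigr => a _.
  rewrite linear_sum /= scaler_sumr -sumrN; apply: eq_bigr => d _.
  rewrite linearZ /= !scalerA -scaleNr; congr (_ *: _).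
  transitivity ('i * 'i * (Om a b' * Om d c')); first by ring.
  by rewrite -expr2 sqrCi mulN1r.
rewrite !expand -opprD [X in _ + X]exchange_big /= -big_split /=.
under eq_bigr => a _.
  rewrite -big_split /=; under eq_bigr => d _.
    rewrite [Om d c * _]mulrC -scalerDr (sf_ope sf) scalerA; over.
  over.
case: eqP => km; last first.
  rewrite scale0r big1 ?oppr0 // => a _; rewrite big1 // => d _.
  by rewrite mulr0 scale0r.
under eq_bigr do rewrite -scaler_suml.
rewrite -scaler_suml -scaleNr; congr (_ *: _).
have S a : \sum_d Om a b * Om d c * (k%:~R * invmx Om a d) = k%:~R * (Om a b * (a == c)%:R).
  by rewrite -(sum_iOm_Om Om_unit) !mulr_sumr; apply: eq_bigr => d _; ring.
under eq_bigr do rewrite S.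
rewrite (bigD1 c) //= big1 => [|a /negPf->]; last by rewrite !mulr0.
by rewrite addr0 eqxx mulr1 [Om c b]Om_skew mulrN opprK.
Qed.

Lemma conj_spec : exists f : W -> W, [/\ forall (a : C) x y, f (a *: x + y) = a^* *: f x + f y,
  f (vac W) = vac W
  & forall p x, f (creation p x) = nprod (conj_eta p.1) (- p.2%:Z - 1) (parity (f x))].
Proof.
apply: (fock_universal sf Num.conj (U := W)
  (A := fun p x => nprod (conj_eta p.1) (- p.2%:Z - 1) (parity x))) => [p a x y|p q x].
  by rewrite !linearP.
rewrite !parity_conj_eta !(parityK sf) !linearN /=; congr (- _); apply/eqP.
rewrite -addr_eq0; apply/eqP; rewrite conj_eta_ope (_ : _ == 0 = false) ?scale0r //; lia.
Qed.

Definition rho : W -> W := projT1 (cid conj_spec).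

Lemma rho_antilinear (a : C) x y : rho (a *: x + y) = a^* *: rho x + rho y.
Proof. by rewrite /rho; case: cid => f []. Qed.

Lemma rho_vac : rho (vac W) = vac W.
Proof. by rewrite /rho; case: cid => f []. Qed.

Lemma rho_creation p x :
  rho (creation p x) = nprod (conj_eta p.1) (- p.2%:Z - 1) (parity (rho x)).
Proof. by rewrite /rho; case: cid => f []. Qed.

Lemma rho0 : rho 0 = 0.
Proof. by have := rho_antilinear (-1) 0 0; rewrite scaler0 addr0 rmorphN1 scaleN1r addNr. Qed.

Lemma rhoZ (a : C) x : rho (a *: x) = a^* *: rho x.
Proof. by rewrite -[a *: x]addr0 rho_antilinear rho0 addr0. Qed.

Lemma rhoD x y : rho (x + y) = rho x + rho y.
Proof. by rewrite -[x]scale1r rho_antilinear rmorph1 !scale1r. Qed.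

Lemma rhoN x : rho (- x) = - rho x.
Proof. by rewrite -scaleN1r rhoZ rmorphN1 scaleN1r. Qed.

Lemma rhoB x y : rho (x - y) = rho x - rho y.
Proof. by rewrite rhoD rhoN. Qed.

Lemma rho_sum (I : Type) (r : seq I) (S : pred I) (f : I -> W) :
  rho (\sum_(i <- r | S i) f i) = \sum_(i <- r | S i) rho (f i).
Proof. by apply: (big_morph rho); [exact: rhoD | exact: rho0]. Qed.

Lemma rho_subspace (P : W -> Prop) : subspace P -> subspace (fun x => P (rho x)).
Proof.
by case=> P0 lin; split=> [|a x y Px Py]; rewrite ?rho0 ?rho_antilinear //; apply: lin.
Qed.

Lemma rho_parity x : rho (parity x) = parity (rho x).
Proof.
elim/(fock_rect sf): x => [||p x IH].
- split=> [|a y z Hy Hz]; first by rewrite linear0 rho0 linear0.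
  by rewrite linearP /= !rho_antilinear Hy Hz linearP.
- by rewrite parity_vac rho_vac parity_vac.
by rewrite parity_creation rhoN !rho_creation IH parity_conj_eta.
Qed.

(** The creation modes are covered by construction, and the anticommutation
    relations transfer the formula to the other modes. *)
Lemma rho_mode b k x : rho (nprod (eta b) k x) = nprod (conj_eta b) k (parity (rho x)).
Proof.
have [k0|k0] := lerP 0 k; last first.
  by rewrite mode_neg // rho_creation /=; congr (nprod _ _ _); lia.
elim/(fock_rect sf): x => [||p x IH].
- split=> [|a y z Hy Hz]; first by rewrite linear0 rho0 !linear0.
  by rewrite linearP /= !rho_antilinear Hy Hz !linearP.
- by rewrite mode_vac // rho0 rho_vac parity_vac nprod_vacr.
rewrite (mode_creation sf) rhoB rhoZ !rho_creation IH !parity_conj_eta !parityK !linearN /= opprK.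
rewrite (canRL (addrK _) (conj_eta_ope b p.1 _ _ _)) opprB addrC; congr (_ + _).
rewrite -scaleNr; congr (_ *: _); rewrite (_ : (k + _ == 0) = (k == p.2.+1)); last by lia.
case: eqP => _; last by rewrite rmorph0 oppr0.
by rewrite rmorphM /= rmorph_int conj_invmx [Om b _]Om_skew mulrN opprK.
Qed.

Lemma conj_sum_conj_eta b k x :
  \sum_a (Om b a)^* *: nprod (conj_eta a) k x = - 'i *: nprod (eta b) k x.
Proof.
under eq_bigr do rewrite conj_eta_nprod scaler_sumr.
rewrite exchange_big /= (bigD1 b) //= [X in _ + X]big1 => [|d bd].
  under eq_bigr do rewrite scalerA conj_Om.
  rewrite -scaler_suml addr0; congr (_ *: _).
  under eq_bigr do rewrite mulrCA [_ * Om _ _]mulrC.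
  by rewrite -mulr_sumr (sum_Om_iOm Om_unit) eqxx mulr1.
under eq_bigr do rewrite scalerA conj_Om.
rewrite -scaler_suml; under eq_bigr do rewrite mulrCA [_ * Om _ _]mulrC.
by rewrite -mulr_sumr (sum_Om_iOm Om_unit) (negPf bd) mulr0 scale0r.
Qed.

Lemma rhoK2 x : rho (rho x) = parity x.
Proof.
elim/(fock_rect sf): x => [||p x IH].
- split=> [|a y z Hy Hz]; first by rewrite !rho0 linear0.
  by rewrite !rho_antilinear conjCK Hy Hz linearP.
- by rewrite !rho_vac parity_vac.
rewrite rho_creation conj_eta_nprod rho_sum parity_creation.
under eq_bigr => a _.
  rewrite rhoZ rho_mode -rho_parity parityK IH rmorphM rmorphN /= conjCi opprK -scalerA.
  rewrite [Om a _]Om_skew rmorphN scaleNr scalerN; over.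
rewrite sumrN -scaler_sumr conj_sum_conj_eta scalerA mulrN -expr2 sqrCi opprK scale1r.
by [].
Qed.

Lemma par_rho e x : par W e x -> par W e (rho x).
Proof.
move/(par_parity_span sf); apply: (lspan_ind (P := fun x => par W e (rho x))) => [|_ [w [<- ->]]].
  exact: rho_subspace (par_subspace e).
elim: w => [|p w IH]; first by rewrite rho_vac; apply: par_vac.
rewrite monomial_cons rho_creation [odd _]/= -[~~ _]addTb.
by apply: par_nprod (par_conj_eta _) (par_parity sf IH).
Qed.

Lemma iter_parity_nprod (j : nat) e x m u : par W e x ->
  iter j parity (nprod x m u) = (-1) ^+ (e * j) *: nprod x m (iter j parity u).
Proof.
move=> px; elim: j => [|j /= ->]; first by rewrite muln0 scale1r.
by rewrite linearZ /= (parity_nprod sf _ _ px) scalerA -exprD mulnS addnC.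
Qed.

Lemma iter_parityE (j : nat) e x : par W e x -> iter j parity x = (-1) ^+ (e * j) *: x.
Proof.
move=> px; elim: j => [|j /= ->]; first by rewrite muln0 scale1r.
by rewrite linearZ /= (parity_par sf px) scalerA -exprD mulnS addnC.
Qed.

(** The iterate formula expresses the field of [mono (p :: w)] through those of
    [mono w] and of a generator, for which the claim is known. Its coefficients
    are real, so the same formula holds for the images under [rho]. *)
Lemma rho_nprod_mono w m y :
  rho (nprod (mono w) m y) = nprod (rho (mono w)) m (iter (size w) parity (rho y)).
Proof.
elim: w m y => [|p w IH] m y.
  by rewrite /= rho_vac !nprod_vacl; case: eqP => _ //; rewrite rho0.
pose e := odd (size w); pose k0 : int := - p.2%:Z - 1.
have pw : par W e (mono w) := par_mono sf w.
have prw : par W e (rho (mono w)) := par_rho pw.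
have [N HN] := nprod_iterate k0 m y (sf_odd sf p.1) pw.
have [N' HN'] := nprod_iterate k0 m (iter (size w).+1 parity (rho y)) (par_conj_eta p.1) prw.
pose M := maxn N N'.
rewrite monomial_cons rho_creation (parity_par sf prw) linearZ nprodZl /=.
rewrite -/k0 -iterS (HN' M) ?leq_maxr //.
rewrite /creation -/k0 (HN M) ?leq_maxl // rho_sum scaler_sumr; apply: eq_bigr => j _.
have swap (a b : C) z : a *: (b *: z) = b *: (a *: z) by rewrite !scalerA mulrC.
rewrite rhoZ rmorphM rmorphXn rmorphN1 /= gbinom_conj [RHS]swap; congr (_ *: _).
rewrite rhoB rhoZ rho_mode !IH rho_mode (parity_nprod sf _ _ prw) linearZ /=.
rewrite (iter_parity_nprod _ _ _ (par_conj_eta p.1)) mul1n (_ : (-1) ^+ size w = (-1) ^+ e); last by rewrite /e signr_odd.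
rewrite [nprod _ _ (_ *: _)] linearZ /= -iterSr /=.
rewrite [RHS]scalerBr -scalerN [RHS]addrC [LHS]addrC -!scaleNr; congr (_ + _).
rewrite swap; congr (_ *: (- _ *: _)).
by rewrite rmorphM /= fmorphXz rmorphN1 rmorph_sign.
Qed.

Lemma rho_nprod e x m y : par W e x ->
  rho (nprod x m y) = nprod (rho x) m (iter e parity (rho y)).
Proof.
move/(par_parity_span sf); apply: (lspan_ind
  (P := fun x => rho (nprod x m y) = nprod (rho x) m (iter e parity (rho y)))) => [|_ [w [<- ->]]].
  split=> [|a z z' Hz Hz']; first by rewrite nprod0l rho0 nprod0l.
  by rewrite nprodDl nprodZl !rho_antilinear Hz Hz' nprodDl nprodZl.
rewrite rho_nprod_mono; congr (nprod _ _ _).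
have [y0 [y1 [/(parity_span_par sf)/par_rho p0 /(parity_span_par sf)/par_rho p1 ->]]] :=
  parity_span_decomposition sf y.
have addE (j : nat) u v : iter j parity (u + v) = iter j parity u + iter j parity v.
  by elim: j => //= j ->; rewrite linearD.
rewrite rhoD !addE !(iter_parityE _ p0) !(iter_parityE _ p1) !mul0n !mul1n.
by rewrite signr_odd.
Qed.

Lemma rho_deriv x : rho (Defs.deriv x) = Defs.deriv (rho x).
Proof.
have derivE y : Defs.deriv y = nprod y (-2) (vac W).
  have := deriv_nprod y (-1) (vac W).
  by rewrite deriv_vac linear0 subr0 nprod_create mulrNz opprK scale1r.
elim/(fock_ind sf): x => [|w].
  split=> [|a y z Hy Hz]; first by rewrite linear0 rho0 linear0.
  by rewrite linearP !rho_antilinear Hy Hz linearP.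
rewrite !derivE rho_nprod_mono rho_vac; congr (nprod _ _ _).
by elim: (size w) => //= j ->; apply: parity_vac.
Qed.

Lemma rho_eta b : rho (eta b) = conj_eta b.
Proof.
rewrite etaE rho_creation rho_vac parity_vac /= oppr0 add0r nprod_create //.
Qed.

(** One of the two images of generators in rho(T) is contracted with the
    conjugate of [Om] by [conj_sum_conj_eta]; the definition of the other one
    puts [Om] back. *)
Lemma rho_stress_tensor : rho T = T.
Proof.
rewrite (stress_tensorE (Om := Om)) rhoZ fmorphV rmorph_nat; congr (_ *: _).
have creE a x : creation (a, 0%N) x = nprod (eta a) (-1) x by rewrite /creation oppr0 add0r.
transitivity (\sum_a 'i *: nprod (conj_eta a) (-1) (eta a)).
  rewrite rho_sum; apply: eq_bigr => a _; rewrite rho_sum.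
  transitivity (- nprod (conj_eta a) (-1) (\sum_b (Om a b)^* *: nprod (conj_eta b) (-1) (vac W))).
    rewrite linear_sum -sumrN; apply: eq_bigr => b _; rewrite rhoZ linearZ /= -scalerN.
    by rewrite !creE !rho_mode parity_conj_eta parityK rho_vac linearN.
  by rewrite conj_sum_conj_eta linearZ /= nprod_create scaleNr opprK.
rewrite exchange_big /=; apply: eq_bigr => a _.
rewrite conj_eta_nprod scaler_sumr; apply: eq_bigr => b _.
by rewrite -etaE creE scalerA mulrA mulrN -expr2 sqrCi opprK mul1r.
Qed.

Lemma filt_rho_mono w : F (size w) (rho (mono w)).
Proof.
have sub k := filt_subspaceE (eta := eta) k.
elim: w => [|p w IH]; first by rewrite rho_vac; apply: (filt_mono_size (eta := eta) [::]).
rewrite monomial_cons rho_creation (parity_par sf (par_rho (par_mono sf w))) linearZ /=.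
apply: (subspaceZ _ (sub _)); rewrite conj_eta_nprod; apply: (subspace_sum _ (sub _)) => a _.
apply: (subspaceZ _ (sub _)); rewrite (_ : (size (p :: w))%:Z = (size w)%:Z + 1); last by rewrite /=; lia.
exact: (filt_mode sf).
Qed.

Lemma filt_rho k x : F k x -> F k (rho x).
Proof.
apply: (filt_ind (P := fun x => F k (rho x))) => [|w i E].
  exact/rho_subspace/filt_subspaceE.
have := filt_widen i (filt_rho_mono w); by rewrite E subrK.
Qed.

Lemma filt_dilation t k x : F k x -> F k (dilation t x).
Proof.
apply: (filt_ind (P := fun x => F k (dilation t x))) => [|w i E].
  have [F0 lin] := filt_subspaceE (eta := eta) k.
  by split=> [|a y z Fy Fz]; rewrite ?linear0 // linearP; apply: lin.
rewrite dilation_mono; apply: subspaceZ; first exact: filt_subspaceE.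
exact: filt_mono E.
Qed.

Lemma filt_rhoE k x : F k x <-> F k (rho x).
Proof.
split=> [|/filt_rho]; first exact: filt_rho.
by rewrite rhoK2 => /(filt_dilation (-1)); rewrite -/(parity _) parityK.
Qed.

Lemma conjugation_rho : conjugation T F rho.
Proof.
split.
- exact: rho_antilinear.
- exists (fun x => parity (rho x)) => x; last by rewrite rho_parity rhoK2 parityK.
  by rewrite rhoK2 parityK.
- exact: rho_deriv.
- exact: rho_vac.
- move=> e f x y m px py; rewrite (rho_nprod _ _ px) (iter_parityE _ (par_rho py)) linearZ /=.
  by rewrite mulnb andbC.
- exact: rho_stress_tensor.
exact: filt_rhoE.
Qed.

Lemma rho_on_generators_rho : rho_on_generators Om eta rho.
Proof. exact: rho_eta. Qed.

(** A conjugation is determined on the monomials by its values on the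
    generators. *)
Lemma conjugation_unique (rho' : W -> W) :
  conjugation T F rho' -> rho_on_generators Om eta rho' -> rho' =1 rho.
Proof.
move=> [anti _ _ fvac fn _ _] gen x; elim/(fock_ind sf): x => [|w].
  split=> [|a y z Hy Hz]; last by rewrite anti rho_antilinear Hy Hz.
  by have := anti (-1) 0 0; rewrite scaler0 addr0 rmorphN1 scaleN1r addNr rho0.
elim: w => [|p w IH]; first by rewrite fvac rho_vac.
rewrite [monomial _ _]/= (fn _ _ _ _ _ (sf_odd sf p.1) (par_mono sf w)) IH gen.
by rewrite (conj_nprod conjugation_rho _ (sf_odd sf p.1) (par_mono sf w)) rho_eta.
Qed.

Lemma dilation_conj_eta t p y : dilation t (nprod (conj_eta p.1) (- p.2%:Z - 1) y) =
  t *: nprod (conj_eta p.1) (- p.2%:Z - 1) (dilation t y).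
Proof.
rewrite !conj_eta_nprod linear_sum scaler_sumr; apply: eq_bigr => a _.
rewrite linearZ /= -[nprod (eta a) _ y]/(creation (a, p.2) y) dilation_creation.
by rewrite !scalerA mulrC.
Qed.

(** The antilinear map rho preserves the degree and turns i^l into its
    inverse. *)
Lemma dilation_rho x : dilation 'i (rho (dilation 'i x)) = rho x.
Proof.
elim/(fock_ind sf): x => [|w].
  split=> [|a y z Hy Hz]; first by rewrite linear0 rho0 linear0.
  by rewrite linearP /= !rho_antilinear linearP /= Hy Hz.
elim: w => [|p w IH]; first by rewrite dilation_vac rho_vac dilation_vac.
rewrite monomial_cons dilation_creation rhoZ !rho_creation linearZ /= dilation_conj_eta scalerA conjCi.
rewrite mulNr -expr2 sqrCi opprK scale1r; congr (nprod _ _ _).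
by rewrite -IH parity_dilation.
Qed.

End Conjugation.

(** * Graded unitarity *)

Section GradedUnitarity.
Context {C : numClosedFieldType} {n : nat} {Om : 'M[C]_n}.
Context {W : vertexAlgebra C} {eta : 'I_n -> W}.
Hypothesis sf : symplectic_fermions Om eta.
Hypothesis Om_unitary : Om \is unitarymx.
Hypothesis Om_skew : forall a b, Om b a = - Om a b.
Local Notation letter := ('I_n * nat)%type.
Local Notation mono := (monomial eta).
Local Notation creation := (creation (eta := eta)).
Local Notation parity := (parity sf).
Local Notation dilation := (dilation sf).
Local Notation form := (form sf).
Local Notation rho := (rho sf Om_unitary Om_skew).
Local Notation T := (stress_tensor Om eta).
Local Notation F := (Sf_filt eta).
Implicit Types (x y z u v : W) (p q : letter) (w : seq letter) (a b c d : 'I_n) (k l m : int).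

Let Om_unit : Om \in unitmx := unitarymx_unit Om_unitary.

Definition theta x : W := dilation 'i (rho x).

Lemma theta_antilinear (a : C) x y : theta (a *: x + y) = a^* *: theta x + theta y.
Proof. by rewrite /theta rho_antilinear linearP. Qed.

Lemma theta0 : theta 0 = 0.
Proof. by rewrite /theta rho0 linear0. Qed.

(** This makes [theta] invertible, which transfers the nondegeneracy of the
    Hermitian form to the bilinear form. *)
Lemma thetaK2 x : theta (theta x) = parity x.
Proof. by rewrite /theta dilation_rho rhoK2. Qed.

(** The adjoint of [creation p] for the Hermitian form. *)
Definition annihilation p x : W := \sum_a Om p.1 a *: nprod (eta a) p.2.+1 x.

Lemma annihilation_linear p : linear (annihilation p).
Proof.
move=> a x y; rewrite /annihilation scaler_sumr -big_split; apply: eq_bigr => b _ /=.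
by rewrite linearP scalerDr !scalerA mulrC.
Qed.

HB.instance Definition _ p :=
  GRing.isLinear.Build C W W _ (annihilation p) (annihilation_linear p).

Lemma annihilation_vac p : annihilation p (vac W) = 0.
Proof. by rewrite /annihilation big1 // => a _; rewrite mode_vac // scaler0. Qed.

(** The factor [Om] in the annihilation operators cancels its inverse in the
    relations of the generators: what is left are the diagonal relations of a
    standard fermionic Fock space. *)
Lemma annihilation_creation p q x : annihilation p (creation q x) =
  (if p == q then p.2.+1%:R else 0) *: x - creation q (annihilation p x).
Proof.
rewrite /annihilation linear_sum /= -sumrN.
under eq_bigr do rewrite (mode_creation sf) scalerBr scalerA.
rewrite sumrB -sumrN; congr (_ + _); last first.
  apply: eq_bigr => a _; by congr (- _); rewrite linearZ.
rewrite -scaler_suml; congr (_ *: _).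
have -> : (p == q) = (p.1 == q.1) && (p.2 == q.2) by case: (p) (q) => [? ?] [? ?].
have [e2|] := eqVneq (p.2.+1%:Z) q.2.+1; last first.
  move=> ne; rewrite big1 => [|a _]; last by rewrite mulr0.
  by rewrite (_ : p.2 == q.2 = false) ?andbF //; lia.
under eq_bigr do rewrite mulrCA.
rewrite -mulr_sumr (sum_Om_iOm Om_unit) (_ : p.2 == q.2) ?andbT; last by lia.
by case: eqP; rewrite ?mulr1 ?mulr0.
Qed.

Lemma annihilation_notin p w : p \notin w -> annihilation p (mono w) = 0.
Proof.
elim: w => [|q w IH]; first by rewrite annihilation_vac.
rewrite inE negb_or => /andP[/negPf pq /IH e].
by rewrite monomial_cons annihilation_creation pq scale0r e linear0 subr0.
Qed.

Definition hform x y : C := form (theta x) y.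

Lemma hform_vac y : hform (vac W) y = vev sf y.
Proof. by rewrite /hform /theta rho_vac dilation_vac form_vac. Qed.

(** The factors i from sigma, - i from rho and the sign from [form_mode] combine
    with the skewness of [Om] to a positive sign. *)
Lemma hform_creation p x y : hform (creation p x) y = hform x (annihilation p y).
Proof.
rewrite /hform /theta rho_creation dilation_conj_eta conj_eta_nprod.
rewrite linearZl_LR linear_sumlz /= mulr_sumr linear_sumr; apply: eq_bigr => a _.
rewrite linearZl_LR linearZr_LR /= (form_mode sf Om_unit Om_skew) -parity_dilation parityK.
rewrite (_ : - (- p.2%:Z - 1) = p.2.+1); last by lia.
rewrite [Om p.1 a]Om_skew; transitivity (- ('i * 'i) * (- Om a p.1) * form (dilation 'i (rho x)) (nprod (eta a) p.2.+1 y)).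
  by ring.
by rewrite -expr2 sqrCi opprK mul1r.
Qed.

Lemma hform_creation_notin w q y : q \notin w -> hform (mono w) (creation q y) = 0.
Proof.
elim: w y => [|p w IH] y; first by rewrite hform_vac vev_creation.
rewrite inE negb_or eq_sym => /andP[/negPf pq qw].
rewrite monomial_cons hform_creation annihilation_creation pq scale0r add0r.
by rewrite /hform linearNr /= -/(hform _ _) IH // oppr0.
Qed.

Definition norm_mono w : nat := \prod_(p <- w) p.2.+1.

(** The operators on the left are moved to the right as annihilation operators.
    If the first letters p and q differ, then either q does not occur on the
    left or p does not occur on the right, since both words are sorted. *)
Lemma hform_mono w w' : sorted mode_lt w -> sorted mode_lt w' ->
  hform (mono w) (mono w') = if w == w' then (norm_mono w)%:R else 0.
Proof.
elim: w w' => [|p w IH] [|q w'] sw sw'.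
- by rewrite hform_vac vev_vac /norm_mono big_nil.
- by rewrite hform_vac monomial_cons vev_creation.
- by rewrite monomial_cons hform_creation annihilation_vac /hform linear0r.
have lt_all (r : letter) s : sorted mode_lt (r :: s) -> forall t, t \in s -> mode_lt r t.
  by move=> /= /(order_path_min mode_lt_trans) /allP.
have notin (r : letter) s : sorted mode_lt (r :: s) -> r \notin s.
  by move=> /sorted_mode_uniq /= /andP[].
have [epq|npq] := eqVneq p q; first subst q.
  have e0 : annihilation p (mono w') = 0 by apply: annihilation_notin; apply: notin sw'.
  rewrite eqseq_cons eqxx !monomial_cons hform_creation annihilation_creation eqxx e0.
  rewrite linear0 subr0 /hform linearZr_LR /= -/(hform _ _).
  rewrite IH ?(path_sorted sw) ?(path_sorted sw') //.
  by case: eqP; rewrite ?mulr0 // /norm_mono big_cons natrM.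
rewrite eqseq_cons (negPf npq) andFb.
have [qw|qw] := boolP (q \in w); last first.
  by rewrite [monomial eta (q :: _)]monomial_cons; apply: hform_creation_notin; rewrite inE negb_or eq_sym npq.
rewrite monomial_cons hform_creation annihilation_notin ?/hform ?linear0r //.
rewrite inE negb_or npq; apply/negP => /(lt_all _ _ sw') qp.
by have := mode_lt_trans (lt_all _ _ sw _ qw) qp; rewrite mode_ltxx.
Qed.

Lemma hform_monol w y : sorted mode_lt w -> hform (mono w) y = (norm_mono w)%:R * coef sf y w.
Proof.
move=> sw; apply: (lspan_ind (P := fun y => hform (mono w) y = (norm_mono w)%:R * coef sf y w))
  (sf_span sf y) => [|_ [w' [sw' ->]]].
  split=> [|a u v Hu Hv].
    have -> : coef sf 0 w = 0.
      by apply/eqP; have := coef_linear sf (-1) 0 0 w; rewrite scaler0 addr0 mulN1r addNr => ->.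
    by rewrite /hform linear0r mulr0.
  by rewrite coef_linear mulrDr mulrCA -Hu -Hv /hform linearPr.
by rewrite hform_mono // coef_mono //; case: eqP; rewrite ?mulr1 ?mulr0.
Qed.

Lemma hformE x y :
  hform x y = \sum_(w <- supp sf x) (coef sf x w)^* * ((norm_mono w)%:R * coef sf y w).
Proof.
have hsum (I : eqType) (r : seq I) (f : I -> W) (c : I -> C) :
    hform (\sum_(i <- r) c i *: f i) y = \sum_(i <- r) (c i)^* * hform (f i) y.
  elim: r => [|i r IH]; first by rewrite !big_nil /hform theta0 linear0l.
  by rewrite !big_cons -IH /hform theta_antilinear linearPl.
rewrite {1}[x](coefE sf) hsum; apply: eq_big_seq => w ws.
by rewrite hform_monol // (supp_sorted ws).
Qed.

Lemma hform_herm x y : hform x y = (hform y x)^*.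
Proof.
pose t := undup (supp sf x ++ supp sf y).
have ut : uniq t by apply: undup_uniq.
rewrite !hformE.
have := supp_widen (V := C^o) (h := Num.conj) (x := x) (t := t)
  (fun w => (norm_mono w)%:R * coef sf y w) (rmorph0 _) ut.
move=> ->; last by move=> w; rewrite mem_undup mem_cat => ->.
have := supp_widen (V := C^o) (h := Num.conj) (x := y) (t := t)
  (fun w => (norm_mono w)%:R * coef sf x w) (rmorph0 _) ut.
move=> ->; last by move=> w; rewrite mem_undup mem_cat orbC => ->.
rewrite rmorph_sum; apply: eq_bigr => w _ /=; rewrite !rmorphM /= conjCK rmorph_nat.
by rewrite /GRing.scale /=; ring.
Qed.

Lemma hform_pos x : x != 0 -> 0 < hform x x.
Proof.
move=> x0; have ge0 w : 0 <= (coef sf x w)^* * ((norm_mono w)%:R * coef sf x w).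
  by rewrite mulrCA mulr_ge0 ?ler0n // mulrC mul_conjC_ge0.
rewrite hformE lt_neqAle sumr_ge0 // andbT eq_sym; apply: contra x0.
rewrite psumr_eq0 // => /allP c0; apply/eqP; rewrite [x](coefE sf) big_seq big1 // => w ws.
have := c0 w ws; rewrite implyTb mulrCA mulf_eq0 pnatr_eq0 eqn0Ngt prodn_gt0 //=.
by rewrite mulrC mul_conjC_eq0 => /eqP ->; rewrite scale0r.
Qed.

Lemma hform_eq0 x : hform x x = 0 -> x = 0.
Proof. by move=> h0; apply/eqP; apply: contraT => /hform_pos; rewrite h0 ltxx. Qed.

(** Positivity gives nondegeneracy on every subspace that is stable under the
    antilinear map relating the two forms. *)
Lemma nondegenerate_theta (P : W -> Prop) :
  (forall x, P x -> P (theta x)) -> (forall x, P x -> P (parity x)) ->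
  nondegenerate_on P form.
Proof.
move=> Pt Ps; split=> [x Px x0|y Py y0]; last by apply: hform_eq0; apply/y0/Pt.
have Pz : P (theta (parity x)) by apply/Pt/Ps.
have zE : theta (theta (parity x)) = x by rewrite thetaK2 parityK.
by rewrite -zE (hform_eq0 (x := theta (parity x))) ?theta0 // /hform zE x0.
Qed.

Lemma filt_theta k x : F k x -> F k (theta x).
Proof. by move=> Fx; apply/filt_dilation/filt_rho. Qed.

Lemma nondegenerate_Sf_filt : nondegenerate_filtration form F.
Proof.
by move=> k; apply: nondegenerate_theta; [exact: filt_theta | exact: filt_dilation].
Qed.

(** The form pairs only vectors of the same degree; here this is expressed by
    operators that distinguish all degrees. *)
Lemma dilation_adjoint t u v : form (dilation t u) v = form u (dilation t v).
Proof.
have dv z : vev sf (dilation t z) = vev sf z.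
  elim/(fock_rect sf): z => [||p z _]; last 2 first.
  - by rewrite dilation_vac.
  - by rewrite dilation_creation -form_vac linearZr_LR /= form_vac !vev_creation mulr0.
  by split=> [|a y z Hy Hz]; rewrite ?linear0 // linearP !vev_linear Hy Hz.
elim/(fock_rect sf): u => [||p u IH] in v *.
- split=> [|a y z Hy Hz] v; first by rewrite linear0 !linear0l.
  by rewrite linearP /= !form_linearl Hy Hz.
- by rewrite dilation_vac !form_vac dv.
rewrite dilation_creation linearZl_LR /= !form_creation IH mulrN; congr (- _).
by rewrite -dilation_annihilation // linearZ /= linearZr_LR parity_dilation.
Qed.

Lemma form_mono_size w w' : size w != size w' -> form (mono w) (mono w') = 0.
Proof.
move=> ne; have := dilation_adjoint 2%:R (mono w) (mono w').
rewrite !dilation_mono linearZl_LR linearZr_LR /= => /eqP; rewrite -subr_eq0 -mulrBl mulf_eq0.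
rewrite -!natrX subr_eq0 eqr_nat eqn_exp2l // (negPf ne).
by move=> /eqP.
Qed.

Lemma Sf_deg_dilation t l x : t != 0 -> Sf_deg eta l x -> dilation t x = t ^ l *: x.
Proof.
move=> t0; apply: (lspan_ind (P := fun x => dilation t x = t ^ l *: x)) => [|_ [w [<- ->]]].
  split=> [|a y z Hy Hz]; first by rewrite linear0 scaler0.
  by rewrite linearP /= Hy Hz scalerDr !scalerA mulrC.
by rewrite dilation_mono.
Qed.

Lemma form_filt_mono k x w : F k x -> k < (size w)%:Z ->
  form x (mono w) = 0 /\ form (mono w) x = 0.
Proof.
move=> Fx kw; apply: (filt_ind (P := fun x => form x (mono w) = 0 /\ form (mono w) x = 0)) Fx
   => [|w' i E].
  split=> [|a y z [Hy Hy'] [Hz Hz']]; first by rewrite linear0l linear0r.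
  by rewrite linearPl linearPr /= Hy Hy' Hz Hz' mulr0 addr0.
by rewrite !form_mono_size //; lia.
Qed.

Lemma filt_split k x : F k x -> exists y z, [/\ Sf_deg eta k y, F (k - 2) z & x = y + z].
Proof.
have subd := lspan_subspace (fun y => exists w, (size w)%:Z = k /\ y = mono w).
have subf := filt_subspaceE (eta := eta) (k - 2).
apply: (filt_ind (P := fun x => exists y z, [/\ Sf_deg eta k y, F (k - 2) z & x = y + z])) => [|w [|i ] E].
- split=> [|a _ _ [y [z [Hy Hz ->]]] [y' [z' [Hy' Hz' ->]]]].
    by exists 0, 0; rewrite addr0; split=> //; [case: subd | case: subf].
  exists (a *: y + y'), (a *: z + z').
  by split; [exact: subd.2 | exact: subf.2 | rewrite scalerDr addrACA].
- exists (mono w), 0; rewrite addr0; split=> //; last by case: subf.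
  by apply: mem_lspan; exists w; split=> //; lia.
exists 0, (mono w); rewrite add0r; split=> //; first by case: subd.
by apply: (filt_mono (i := i)); lia.
Qed.

(** A monomial of length k is orthogonal to all shorter ones, hence refined.
    Conversely, the part of a refined vector in lower degree is orthogonal to
    the smaller filtered component that contains it, so it vanishes by
    nondegeneracy. *)
Lemma is_sigma_dilation : is_sigma T form F (dilation 'i).
Proof.
split=> [|x|h k x [_ Fx orth]]; first exact: dilation_linear.
  elim/(fock_ind sf): x => [|w]; first exact: lspan_subspace.
  apply: mem_lspan; exists (2 * (wt w)%:Z), (size w)%:Z; split.
  - exact: weight_mono sf Om_unit Om_skew w.
  - exact: filt_mono_size.
  by move=> y /form_filt_mono Fy; have [|? ?] := Fy w; [lia | split].
have [y [z [dy Fz xE]]] := filt_split Fx.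
suff z0 : z = 0 by rewrite xE z0 addr0; apply: Sf_deg_dilation dy; apply: neq0Ci.
have [nd _] := nondegenerate_Sf_filt (k - 2).
apply: nd => // u Fu.
have yu : form y u = 0.
  apply: (lspan_ind (P := fun y => form y u = 0)) dy => [|_ [w [wk ->]]].
    split=> [|a v v' Hv Hv']; first by rewrite linear0l.
    by rewrite linearPl /= Hv Hv' mulr0 addr0.
  by have [] := form_filt_mono (w := w) Fu; [lia |].
by have [] := orth u Fu; rewrite xE linearDl /= yu add0r.
Qed.

Lemma graded_unitary_Sf :
  graded_unitary T (Sf_Z2 eta) F form (dilation 'i) rho.
Proof.
split.
- exact: is_VOA_stress_tensor sf Om_unit Om_skew.
- exact: Z2_graded_Sf_Z2 sf.
- exact: invariant_form_form sf Om_unit Om_skew.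
- exact: nondegenerate_theta.
- exact: half_integral_Sf_filt sf.
- exact: good_Sf_filt sf.
- exact: nondegenerate_Sf_filt.
- exact: is_sigma_dilation.
- exact: conjugation_rho.
- split=> [e x /(Sf_Z2E sf) px|x]; last exact: dilation_rho.
  by rewrite rhoK2 (parity_par sf px).
- exact: hform_herm.
exact: hform_pos.
Qed.

End GradedUnitarity.

Lemma gram_skew (C : fieldType) (V : vectType C) (Omega : {skew_symmetric V})
    (n : nat) (e : n.-tuple V) a b : gram Omega e b a = - gram Omega e a b.
Proof.
rewrite !mxE; have := hermitian_subproof (tnth e b) (tnth e a) (s := Omega).
by rewrite expr1 mulN1r.
Qed.

Theorem proposition2p38 (R : realType) (V : vectType R[i])
  (Omega : {skew_symmetric V}) (hOmega : is_psymplectic Omega)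
  (n : nat) (e : n.-tuple V) (he : basis_of fullv e)
  (hunit : gram Omega e \is unitarymx)
  (W : vertexAlgebra R[i]) (eta : 'I_n -> W)
  (hW : symplectic_fermions (gram Omega e) eta) :
  let Om := gram Omega e in
  let T := stress_tensor Om eta in
  exists (B : {biscalar W}) (rho sigma : W -> W),
    [/\ invariant_form T B /\ B (vac W) (vac W) = 1,
        forall B' : {biscalar W}, invariant_form T B' ->
          B' (vac W) (vac W) = 1 -> B' =2 B,
        conjugation T (Sf_filt eta) rho /\ rho_on_generators Om eta rho,
        forall rho' : W -> W, conjugation T (Sf_filt eta) rho' ->
          rho_on_generators Om eta rho' -> rho' =1 rho
      & (forall (l : int) (x : W), Sf_deg eta l x -> sigma x = 'i ^ l *: x) /\
        graded_unitary T (Sf_Z2 eta) (Sf_filt eta) B sigma rho].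
Proof.
move=> Om T; have skew := gram_skew Omega e.
have unit := unitarymx_unit hunit.
exists (form hW), (rho hW hunit skew), (dilation hW 'i); split.
- by split; [exact: invariant_form_form hW unit skew | exact: form_vac_vac].
- exact: invariant_form_unique hW unit skew.
- by split; [exact: conjugation_rho | exact: rho_on_generators_rho].
- exact: conjugation_unique.
split; last exact: graded_unitary_Sf.
by move=> l x; apply: Sf_deg_dilation; apply: neq0Ci.
Qed.
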